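(* (i) Let $c_1<\infty$ and $c_2<\infty$. Then, for any $n\in\mathbb{N}_0$ and any $G^{(n)}\in X_n$, $$\|L_0^{(n)}G^{(n)}\|_{X_n}\le\frac{n(n-1)}{2}(c_1+c_2)\|G^{(n)}\|_{X_n}.$$ Moreover, if additionally $$a_2(x_1,x_2)\le a_1(x_1,x_2)\quad\text{for a.a. }x_1,x_2\in\mathbb{R}^d,$$ then $L_0^{(n)}$ is the generator of a contraction semigroup in $X_n$. (ii) Let $c_3<\infty$ and $c_4<\infty$. Then, for any $n\in\mathbb{N}$ and any $G^{(n-1)}\in X_{n-1}$, $$\|W^{(n)}G^{(n-1)}\|_{X_n}\le n(n-1)(c_3+c_4)\|G^{(n-1)}\|_{X_{n-1}}.$$
   Context: $d\in\mathbb{N}$; $X_n:=L^1((\mathbb{R}^d)^n,dx_1\cdots dx_n)$ for $n\ge1$, $X_0:=\mathbb{R}$. The rate $c:(\mathbb{R}^d)^4\to[0,\infty)$ is measurable and depends only on the unordered pairs $\{x_1,x_2\}$ and $\{y_1,y_2\}$: $c(x_1,x_2,y_1,y_2)=c(x_2,x_1,y_1,y_2)=c(x_1,x_2,y_2,y_1)$; also $c(x_1,x_2,\cdot,\cdot)\in L^1_{\mathrm{loc}}(\mathbb{R}^d\times\mathbb{R}^d)$ for a.a. $x_1,x_2$. Put (all integrals over $\mathbb{R}^d$) $$c_1=\operatorname*{ess\,sup}_{x_1,x_2}\iint c(x_1,x_2,y_1,y_2)\,dy_1dy_2,\qquad c_2=\operatorname*{ess\,sup}_{x_1,x_2}\iint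 c(y_1,y_2,x_1,x_2)\,dy_1dy_2,$$ $$c_3=\operatorname*{ess\,sup}_{x_1}\iiint c(x_1,x_2,y_1,y_2)\,dy_1dy_2dx_2,\qquad c_4=\operatorname*{ess\,sup}_{x_1}\iiint c(y_1,y_2,x_1,x_2)\,dy_1dy_2dx_2,$$ $$a_1(x_1,x_2)=\iint c(x_1,x_2,y_1,y_2)\,dy_1dy_2,\quad a_2(x_1,x_2)=\iint c(y_1,y_2,x_1,x_2)\,dy_1dy_2,\quad \tilde c(x_1,x_2,y_1)=\int c(x_1,x_2,y_1,y_2)\,dy_2 .$$ $L_0^{(0)}=L_0^{(1)}=0$, $W^{(1)}=0$, and for $n\ge2$, $x^{(n)}=(x_1,\dots,x_n)$, $$(L_0^{(n)}G^{(n)})(x^{(n)})=\sum_{1\le i<j\le n}\iint c(x_i,x_j,y_1,y_2)\Bigl(G^{(n)}(x_1,\dots,y_1,\dots,y_2,\dots,x_n)-G^{(n)}(x^{(n)})\Bigr)dy_1dy_2,$$ where $y_1$ and $y_2$ stand at the $i$-th and $j$-th places (replacing $x_i$ and $x_j$), and $$(W^{(n)}G^{(n-1)})(x^{(n)})=\sum_{i=1}^n\sum_{j\ne i}\int\tilde c(x_i,x_j,y_1)\Bigl(G^{(n-1)}\bigl(x^{(n)}\text{ with }x_i\text{ deleted and }x_j\text{ replaced by }y_1\bigr)-G^{(n-1)}\bigl(x^{(n)}\text{ with }x_i\text{ deleted}\bigr)\Bigr)dy_1 .$$ *)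

(* Defs.v *)
From HB Require Import structures.
From mathcomp Require Import all_boot all_order all_algebra.
From mathcomp Require Import all_classical all_reals all_analysis.
From mathcomp Require Import measurable_realfun ess_sup_inf.
Set Implicit Arguments.
Unset Strict Implicit.
Unset Printing Implicit Defensive.
Import Order.TTheory GRing.Theory Num.Theory.
Import numFieldNormedType.Exports.
Local Open Scope classical_set_scope.
Local Open Scope ring_scope.

Section tcons_measure.
Context d (T : measurableType d) (R : realType).
Local Open Scope ereal_scope.

Definition tcons n (p : T * n.-tuple T) : n.+1.-tuple T := [tuple of p.1 :: p.2].

Lemma measurable_tcons n : measurable_fun [set: T * n.-tuple T] (@tcons n).
Proof. exact: measurable_cons. Qed.

Variables (mu : {sigma_finite_measure set T -> \bar R}) (n : nat).
Variable nu : {sigma_finite_measure set (n.-tuple T) -> \bar R}.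

Definition tcons_measure : set (n.+1.-tuple T) -> \bar R :=
  pushforward (mu \x nu) (@tcons n).

Let m := measure_function_pushforward__canonical__measure_function_Measure
  (mu \x nu) (@measurable_tcons n).

Let m0 : tcons_measure set0 = 0.
Proof. exact: (measure0 m). Qed.

Let m_ge0 A : 0 <= tcons_measure A.
Proof. exact: (measure_ge0 m). Qed.

Let m_sigma_additive : semi_sigma_additive tcons_measure.
Proof. exact: (@measure_semi_sigma_additive _ _ _ m). Qed.

HB.instance Definition _ := isMeasure.Build _ _ _
  tcons_measure m0 m_ge0 m_sigma_additive.

Let m_sigma_finite : sigma_finite setT tcons_measure.
Proof.
have /sigma_finiteP[F [TF ndF Foo]] := sigma_finiteT mu.
have /sigma_finiteP[G [TG ndG Goo]] := sigma_finiteT nu.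
pose tuncons (t : n.+1.-tuple T) : T * n.-tuple T :=
  (thead t, [tuple of behead t]).
have mtuncons : measurable_fun setT tuncons.
  apply/measurable_fun_pair; first exact: measurable_tnth.
  exact: measurable_behead.
have tconsK : tuncons \o @tcons n = id.
  by apply/funext => -[x t]; congr pair; apply/val_inj.
exists (fun k => tuncons @^-1` (F k `*` G k)).
  rewrite predeqE => t; split=> // _.
  have [i _ Fi] : (\bigcup_i F i) (thead t) by rewrite -TF.
  have [j _ Gj] : (\bigcup_i G i) [tuple of behead t] by rewrite -TG.
  exists (maxn i j) => //; split.
    by have /subsetPset := ndF _ _ (leq_maxl i j); exact.
  by have /subsetPset := ndG _ _ (leq_maxr i j); exact.
move=> k; have [mF Fk] := Foo k; have [mG Gk] := Goo k; split.
  by rewrite -[X in measurable X]setTI; apply: mtuncons => //; exact: measurableX.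
rewrite /tcons_measure /pushforward -comp_preimage tconsK preimage_id.
by rewrite product_measure1E// lte_mul_pinfty// ge0_fin_numE.
Qed.

HB.instance Definition _ := Measure_isSigmaFinite.Build _ _ _
  tcons_measure m_sigma_finite.
End tcons_measure.

Fixpoint tuple_measure d (T : measurableType d) (R : realType)
    (mu : {sigma_finite_measure set T -> \bar R}) (n : nat) :
    {sigma_finite_measure set (n.-tuple T) -> \bar R} :=
  if n is k.+1 return {sigma_finite_measure set (n.-tuple T) -> \bar R}
  then tcons_measure mu (tuple_measure mu k) else \d_[tuple].

Section L1space.
Context d (T : measurableType d) (R : realType).
Variable mu : {measure set T -> \bar R}.

Definition L1fun := LfunType mu (@lexx _ _ 1%E).
Definition L1space := LspaceType mu (@lexx _ _ 1%E).
HB.instance Definition _ := gen_eqMixin L1space.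
HB.instance Definition _ := gen_choiceMixin L1space.

Implicit Types (f g : L1fun) (u v : L1space) (a : R).

Let ae_eq_Lnorm (f g : T -> R) : measurable_fun setT f -> measurable_fun setT g ->
  f = g %[ae mu] -> ('N[mu]_1[EFin \o f] = 'N[mu]_1[EFin \o g])%E.
Proof.
move=> /measurable_EFinP mf /measurable_EFinP mg fg.
rewrite !Lnorm1. apply: ge0_ae_eq_integral => //.
- exact: measurableT_comp.
- exact: measurableT_comp.
- by apply: filterS fg => x /= fgx Dx; rewrite fgx.
Qed.

Let measurable_L1space u : measurable_fun [set: T] (u : T -> R).
Proof. exact: (@measurable_funPT _ _ _ _ (repr (LebesgueSpace.sort u))). Qed.

Let Lfun_L1space u : (u : T -> R) \in Lfun mu 1.
Proof.
apply/andP; split; rewrite inE /=; first exact: measurable_L1space.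
exact: (@Lebesgue_finite _ _ _ _ _ _ u).
Qed.

Definition L1repr (u : L1space) : L1fun := Lfun_Sub _ (Lfun_L1space u).

Let mfunR_subproof (f : L1fun) : (f : T -> measurableTypeR R) \in mfun.
Proof. by rewrite inE /=; exact: (@measurable_funPT _ _ _ _ f). Qed.

Let mfunR (f : L1fun) : {mfun T >-> measurableTypeR R} :=
  mfun_Sub (mfunR_subproof f).

Let clsm (f : L1fun) : {mfun_ mu, T >-> measurableTypeR R} :=
  (\pi_({mfun_ mu, T >-> measurableTypeR R}) (mfunR f))%qT.

Let clsmP (f : L1fun) : aqEqMfun_to_fun (clsm f) = f %[ae mu].
Proof. by have /eqmodP/asboolP := reprK (clsm f). Qed.

Let measurable_clsm f : measurable_fun [set: T] (clsm f : T -> R).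
Proof. exact: (@measurable_funPT _ _ _ _ (repr (clsm f))). Qed.

Let clsm_fin (f : L1fun) : finite_norm mu 1 (clsm f).
Proof.
rewrite /finite_norm.
rewrite (@ae_eq_Lnorm (clsm f) f (measurable_clsm f) _ (clsmP f)) //.
exact: Lfunction_finite.
Qed.

Definition L1class (f : L1fun) : L1space :=
  LebesgueSpace.Pack (LebesgueSpace.Class
    (isFinLebesgue.Build d T R mu 1%E (@lexx _ _ 1%E) (clsm f) (clsm_fin f))).

Lemma L1classP f : L1repr (L1class f) = f %[ae mu].
Proof. exact: clsmP. Qed.

Let L1space_inj u v : LebesgueSpace.sort u = LebesgueSpace.sort v -> u = v.
Proof.
case: u v => [u [[uf]]] [v [[vf]]] /= uv; case: _ / uv in vf *.
by rewrite (bool_irrelevance uf vf).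
Qed.

Lemma L1class_eq f g : L1class f = L1class g <-> f = g %[ae mu].
Proof.
split=> [fg|fg].
  have := L1classP f; rewrite fg => gf.
  by apply: (ae_eq_trans _ (L1classP g)); exact: ae_eq_sym.
by apply: L1space_inj => /=; apply/eqmodP/asboolP.
Qed.

Lemma L1reprK : cancel L1repr L1class.
Proof.
move=> u; apply: L1space_inj => /=; rewrite -[RHS]reprK.
by apply/eqmodP/asboolP/nearW.
Qed.

Let L1ind (P : L1space -> Prop) : (forall f, P (L1class f)) -> forall u, P u.
Proof. by move=> Pf u; rewrite -(L1reprK u). Qed.

Let L1zero := L1class 0.
Let L1opp u := L1class (- L1repr u).
Let L1add u v := L1class (L1repr u + L1repr v).
Let L1scale a u := L1class (a *: L1repr u).
Let L1norm u := fine 'N[mu]_1[EFin \o u].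

Let L1oppE f : L1opp (L1class f) = L1class (- f).
Proof.
apply/L1class_eq; apply: filterS (L1classP f) => x H Dx.
exact: (congr1 -%R (H Dx)).
Qed.

Let L1addE f g : L1add (L1class f) (L1class g) = L1class (f + g).
Proof.
apply/L1class_eq; apply: filterS2 (L1classP f) (L1classP g).
by move=> x Hf Hg Dx; exact: (congr2 +%R (Hf Dx) (Hg Dx)).
Qed.

Let L1scaleE a f : L1scale a (L1class f) = L1class (a *: f).
Proof.
apply/L1class_eq; apply: filterS (L1classP f) => x H Dx.
exact: (congr1 ( *%R a) (H Dx)).
Qed.

Let L1normE f : L1norm (L1class f) = fine 'N[mu]_1[EFin \o f].
Proof. by congr fine; apply: ae_eq_Lnorm => //; exact: L1classP. Qed.

Let L1addA : associative L1add.
Proof.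
by elim/L1ind=> f; elim/L1ind=> g; elim/L1ind=> h; rewrite !L1addE addrA.
Qed.

Let L1addC : commutative L1add.
Proof. by elim/L1ind=> f; elim/L1ind=> g; rewrite !L1addE addrC. Qed.

Let L1add0 : left_id L1zero L1add.
Proof. by elim/L1ind=> f; rewrite L1addE add0r. Qed.

Let L1addN : left_inverse L1zero L1opp L1add.
Proof. by elim/L1ind=> f; rewrite L1oppE L1addE addNr. Qed.

HB.instance Definition _ :=
  GRing.isZmodule.Build L1space L1addA L1addC L1add0 L1addN.

Let L1scaleA a b u : L1scale a (L1scale b u) = L1scale (a * b) u.
Proof. by elim/L1ind: u => f; rewrite !L1scaleE scalerA. Qed.

Let L1scale1 : left_id 1 L1scale.
Proof. by elim/L1ind=> f; rewrite L1scaleE scale1r. Qed.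

Let L1scaleDr : right_distributive L1scale +%R.
Proof.
move=> a; elim/L1ind=> f; elim/L1ind=> g.
by rewrite [_ + _]L1addE !L1scaleE [RHS]L1addE scalerDr.
Qed.

Let L1scaleDl u : {morph L1scale^~ u : a b / a + b}.
Proof.
by elim/L1ind: u => f a b; rewrite !L1scaleE [RHS]L1addE scalerDl.
Qed.

HB.instance Definition _ := GRing.Zmodule_isLmodule.Build R L1space
  L1scaleA L1scale1 L1scaleDr L1scaleDl.

Let L1normD u v : L1norm (u + v) <= L1norm u + L1norm v.
Proof.
by elim/L1ind: u => f; elim/L1ind: v => g; rewrite [_ + _]L1addE !L1normE ler_LnormD.
Qed.

Let L1normZ a u : L1norm (a *: u) = `|a| * L1norm u.
Proof.
elim/L1ind: u => f; rewrite [_ *: _]L1scaleE !L1normE.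
by rewrite LnormZ -(finite_norm_fine f) -EFinM.
Qed.

Let L1norm0_eq0 u : L1norm u = 0 -> u = 0.
Proof.
elim/L1ind: u => f; rewrite L1normE => /fine_Lnormr_eq0 f0.
exact/L1class_eq.
Qed.

HB.instance Definition _ := Lmodule_isNormed.Build R L1space
  L1normD L1normZ L1norm0_eq0.

Lemma L1normP f : (`|L1class f|)%:E = ('N[mu]_1[EFin \o f])%E.
Proof. by rewrite -finite_norm_fine -L1normE. Qed.

Lemma L1classD f g : L1class (f + g) = L1class f + L1class g.
Proof. by rewrite -L1addE. Qed.
End L1space.

(* Lift of an operator on functions to L^1 classes.  [insubd] returns 0 when
   [F u] is not integrable, so this is the intended operator only for [F]
   satisfying [maps_L1] below. *)
Definition L1map d1 d2 (S : measurableType d1) (T : measurableType d2)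
    (R : realType) (mu : {measure set S -> \bar R})
    (nu : {measure set T -> \bar R}) (F : (S -> R) -> T -> R)
    (u : L1space mu) : L1space nu :=
  L1class (insubd (0 : L1fun nu) (F u)).
Arguments L1map {d1 d2 S T R} mu nu F u.

Definition maps_L1 d1 d2 (S : measurableType d1) (T : measurableType d2)
    (R : realType) (mu : {measure set S -> \bar R})
    (nu : {measure set T -> \bar R}) (F : (S -> R) -> T -> R) : Prop :=
  (forall f, f \in Lfun mu 1 -> F f \in Lfun nu 1) /\
  (forall f g, f \in Lfun mu 1 -> g \in Lfun mu 1 ->
     f = g %[ae mu] -> F f = F g %[ae nu]).

Lemma L1map_class d1 d2 (S : measurableType d1) (T : measurableType d2)
    (R : realType) (mu : {measure set S -> \bar R})
    (nu : {measure set T -> \bar R}) (F : (S -> R) -> T -> R)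
    (f : L1fun mu) (Ff : F f \in Lfun nu 1) :
  maps_L1 mu nu F -> L1map mu nu F (L1class f) = L1class (Lfun_Sub _ Ff).
Proof.
move=> [Flfun Fae]; apply/L1class_eq.
have Fu : F (L1repr (L1class f)) \in Lfun nu 1 by exact/Flfun/LfunP.
have -> : (insubd (0 : L1fun nu) (F (L1class f)) : T -> R) =
    F (L1repr (L1class f)).
  exact: (insubdK _ Fu).
by apply: Fae; [exact: LfunP | exact: LfunP | exact: L1classP].
Qed.

Section semigroup.
Context (R : realType) (V : normedModType R).

(* Only the values [T t] with [0 <= t] are relevant. *)
Definition contraction_semigroup (T : R -> {linear V -> V}) : Prop :=
  [/\ T 0 =1 id,
      forall s t, 0 <= s -> 0 <= t -> T (s + t) =1 T s \o T t,
      forall t u, 0 <= t -> `|T t u| <= `|u|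
    & forall u, T t u @[t --> 0^'+] --> u].

Definition generator (T : R -> {linear V -> V}) : set (V * V) :=
  [set p | h^-1 *: (T h p.1 - p.1) @[h --> 0^'+] --> p.2].

(* For an everywhere defined [A]: the domain of the generator is all of [V]. *)
Definition generates_contraction_semigroup (A : V -> V) : Prop :=
  exists T : R -> {linear V -> V},
    contraction_semigroup T /\ generator T = [set p | p.2 = A p.1].

End semigroup.

Definition Rd (R : realType) (d : nat) : measurableType _ :=
  d.-tuple (measurableTypeR R).

Definition leb (R : realType) (d : nat) :
    {sigma_finite_measure set (Rd R d) -> \bar R} :=
  tuple_measure lebesgue_measure d.

Definition conf_leb (R : realType) (d n : nat) :
    {sigma_finite_measure set (n.-tuple (Rd R d)) -> \bar R} :=
  tuple_measure (leb R d) n.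

(* For n = 0 the underlying space is a point of mass 1, so that X R d 0 is R;
   see X0_norm and X0_surj. *)
Definition X (R : realType) (d n : nat) : normedModType R :=
  L1space (conf_leb R d n).

Lemma X0_norm (R : realType) (d : nat) (f : L1fun (conf_leb R d 0)) :
  `|L1class f : X R d 0| = `|f [tuple]|.
Proof.
apply: EFin_inj; rewrite L1normP Lnorm1 integral_dirac //.
  by rewrite diracT mul1e.
by apply: measurableT_comp => //; exact/measurable_EFinP.
Qed.

Lemma X0_surj (R : realType) (d : nat) (a : R) :
  exists f : L1fun (conf_leb R d 0), f [tuple] = a.
Proof.
exists (Lfun_Sub _ (@Lfun_cst _ _ _ (\d_[tuple] : {finite_measure set _ -> \bar R}) a 1)).
by [].
Qed.

Definition subst_at (T : Type) (n : nat) (x : n.-tuple T) (i : 'I_n) (y : T) :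
    n.-tuple T :=
  [tuple if k == i then y else tnth x k | k < n].

Definition drop_at (T : Type) (n : nat) (x : n.-tuple T) (i : 'I_n) :
    n.-1.-tuple T :=
  [tuple tnth x (lift i k) | k < n.-1].

Section rate.
Context (R : realType) (d : nat).
Local Notation E := (Rd R d).
Local Notation mu := (leb R d).

Definition to_rV (y : E * E) : 'rV[R]_d * 'rV[R]_d :=
  (\row_i tnth y.1 i, \row_i tnth y.2 i).

(* [E] carries no topology in the library: compactness of [K] is that of its
   image under the identification of tuples with row vectors. *)
Definition L1loc (f : E * E -> R) : Prop :=
  measurable_fun [set: E * E] f /\
  forall K : set (E * E), compact (to_rV @` K) ->
    (\int[mu \x mu]_(y in K) `|f y|%:E < +oo)%E.

Variable c : E -> E -> E -> E -> R.
Local Open Scope ereal_scope.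

Definition a1 (x1 x2 : E) : \bar R :=
  \int[mu \x mu]_y (c x1 x2 y.1 y.2)%:E.

Definition a2 (x1 x2 : E) : \bar R :=
  \int[mu \x mu]_y (c y.1 y.2 x1 x2)%:E.

Definition ctilde (x1 x2 y1 : E) : \bar R := \int[mu]_y2 (c x1 x2 y1 y2)%:E.

Definition c1 : \bar R :=
  ess_sup (mu \x mu) (fun x => \int[mu \x mu]_y (c x.1 x.2 y.1 y.2)%:E).

Definition c2 : \bar R :=
  ess_sup (mu \x mu) (fun x => \int[mu \x mu]_y (c y.1 y.2 x.1 x.2)%:E).

Definition c3 : \bar R :=
  ess_sup mu (fun x1 =>
    \int[mu \x mu \x mu]_z (c x1 z.2 z.1.1 z.1.2)%:E).

Definition c4 : \bar R :=
  ess_sup mu (fun x1 =>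
    \int[mu \x mu \x mu]_z (c z.1.1 z.1.2 x1 z.2)%:E).

Local Close Scope ereal_scope.

Definition L0_integrand (n : nat) (G : n.-tuple E -> R) (x : n.-tuple E)
    (i j : 'I_n) (y : E * E) : R :=
  c (tnth x i) (tnth x j) y.1 y.2 *
    (G (subst_at (subst_at x i y.1) j y.2) - G x).

Definition L0_fun (n : nat) (G : n.-tuple E -> R) (x : n.-tuple E) : R :=
  \sum_(i < n) \sum_(j < n | (i < j)%N)
    \int[(mu \x mu)%E]_y L0_integrand G x i j y.

(* The real-valued integrals above are 0 when divergent; [L0_cvg] and [W_cvg]
   state that at the point [x] they all converge absolutely. *)
Definition L0_cvg (n : nat) (G : n.-tuple E -> R) (x : n.-tuple E) : Prop :=
  forall i j : 'I_n, (i < j)%N ->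
    (mu \x mu)%E.-integrable setT (EFin \o L0_integrand G x i j).

Definition W_integrand (n : nat) (G : n.-1.-tuple E -> R) (x : n.-tuple E)
    (i j : 'I_n) (y1 : E) : \bar R :=
  (ctilde (tnth x i) (tnth x j) y1 *
    (G (drop_at (subst_at x j y1) i) - G (drop_at x i))%:E)%E.

Definition W_fun (n : nat) (G : n.-1.-tuple E -> R) (x : n.-tuple E) : R :=
  \sum_(i < n) \sum_(j < n | j != i) fine (\int[mu]_y1 W_integrand G x i j y1)%E.

Definition W_cvg (n : nat) (G : n.-1.-tuple E -> R) (x : n.-tuple E) : Prop :=
  forall i j : 'I_n, j != i -> mu.-integrable setT (W_integrand G x i j).

Definition L0_well_defined (n : nat) : Prop :=
  maps_L1 (conf_leb R d n) (conf_leb R d n) (@L0_fun n) /\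
  forall G, G \in Lfun (conf_leb R d n) 1 ->
    \forall x \ae conf_leb R d n, L0_cvg G x.

Definition W_well_defined (n : nat) : Prop :=
  maps_L1 (conf_leb R d n.-1) (conf_leb R d n) (@W_fun n) /\
  forall G, G \in Lfun (conf_leb R d n.-1) 1 ->
    \forall x \ae conf_leb R d n, W_cvg G x.

(* For n <= 1 the sums are empty: L0 c 0 = L0 c 1 = 0 and W c 1 = 0. *)
Definition L0 (n : nat) : X R d n -> X R d n :=
  L1map (conf_leb R d n) (conf_leb R d n) (@L0_fun n).

Definition W (n : nat) : X R d n.-1 -> X R d n :=
  L1map (conf_leb R d n.-1) (conf_leb R d n) (@W_fun n).

End rate.

(* Main.v *)
(* Exchanging the coordinate x_i of an n-tuple with an integration variable
   preserves Lebesgue measure.  Exchanging (x_i, x_j) with (y_1, y_2) thus turns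
   the gain term of L_0 into multiplication by a_2(x_i, x_j), whereas the loss
   term is multiplication by a_1(x_i, x_j); the bounds on L_0 follow by summing
   over pairs, and those on W in the same way, with one coordinate integrated out.

   When a_2 <= a_1, the step 1 + h L_0 is a contraction for small h > 0: pointwise
     |G + h L_0 G| + h sum a_1 |G| <= |G| + h (gain of |G|),
   and after integration the gain is at most the sum of a_1 |G|.  With
   B := 1 + h L_0 the semigroup is then exp(-t/h) exp((t/h) B), a convex
   combination of powers of the contraction B.  The series converges because L^1
   is complete (by dominated convergence), and the semigroup law and the generator
   are obtained from the scalar exponential: a polynomial p with nonnegative
   coefficients satisfies |p(B) u| <= p(1) |u|. *)
Require Import Defs.
From HB Require Import structures.
From mathcomp Require Import all_boot all_order all_algebra.
From mathcomp Require Import all_classical all_reals all_analysis.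
From mathcomp Require Import measurable_realfun ess_sup_inf.
From mathcomp Require Import ring lra.
Set Implicit Arguments.
Unset Strict Implicit.
Unset Printing Implicit Defensive.
Import Order.TTheory GRing.Theory Num.Theory.
Import numFieldNormedType.Exports.
Local Open Scope classical_set_scope.
Local Open Scope ring_scope.

(** * Integration over tuples *)

(** Gain minus loss cannot be fed to Tonelli: for a general [G] either part may diverge at a point,
    and the real-valued integral then defaults to 0. Hence every exchange of variables is made for
    nonnegative extended-valued functions, and a signed [G] enters through |G| only. Two weighted
    bounds for nonnegative functions, one for the gain and one for the loss, already yield a.e.
    convergence, the norm bound and invariance under a.e. equality. The summands of [L0_fun] and
    [W_fun] share the shape [kernel_op], so this is done once.

    For the same reason the loss stands on the left of the contraction inequality instead of being
    subtracted on the right; it cancels only after integration, when the bound on a_1 makes it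
    finite. Small h means that h times n(n-1)/2 times c_1 is at most 1, which keeps the coefficient
    1 - h sum a_1 of G nonnegative; thus h depends on n but not on G.

    The semigroup T_t satisfies |T_t u - u - t L_0 u| <= 2 (t/h)^2 |u| for every u. This single
    estimate gives strong continuity and a generator defined on the whole space. *)

Section tonelli.
Context d1 d2 (S : measurableType d1) (T : measurableType d2) (R : realType).
Variables (m1 : {sigma_finite_measure set S -> \bar R}).
Variables (m2 : {sigma_finite_measure set T -> \bar R}).
Local Open Scope ereal_scope.

Lemma measurable_int_r (F : S -> T -> \bar R) :
  (forall x y, 0 <= F x y) ->
  measurable_fun [set: S * T] (fun z => F z.1 z.2) ->
  measurable_fun setT (fun x => \int[m2]_y F x y).
Proof.
by move=> F0 mF; exact: (measurable_fun_fubini_tonelli_F (fun z => F z.1 z.2)).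
Qed.

(** The integral of a signed function is by definition the difference, in the extended reals, of the
    integrals of its positive and negative parts. Each of these is measurable in [x], hence so is
    the difference, including where it reads +oo - oo. *)
Lemma measurable_int_r_fine (F : S -> T -> \bar R) :
  measurable_fun [set: S * T] (fun z => F z.1 z.2) ->
  measurable_fun setT (fun x => fine (\int[m2]_y F x y)).
Proof.
move=> mF; pose G (z : S * T) := F z.1 z.2.
have mFpos : measurable_fun setT (fun x => \int[m2]_y G^\+ (x, y)).
  apply: (measurable_fun_fubini_tonelli_F G^\+) => //.
  exact: measurable_funepos.
have mFneg : measurable_fun setT (fun x => \int[m2]_y G^\- (x, y)).
  apply: (measurable_fun_fubini_tonelli_F G^\-) => //.
  exact: measurable_funeneg.
apply: (measurableT_comp (f := @fine R) (g := fun x => \int[m2]_y F x y)) => //.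
rewrite (_ : (fun x => _) =
    (fun x => \int[m2]_y G^\+ (x, y) - \int[m2]_y G^\- (x, y))).
  exact: emeasurable_funB.
apply/funext => x; rewrite [LHS]integralE.
by congr (_ - _); apply: eq_integral => y _; rewrite ?funeposE ?funenegE.
Qed.

Lemma tonelli_swap (F : S -> T -> \bar R) :
  (forall x y, 0 <= F x y) ->
  measurable_fun [set: S * T] (fun z => F z.1 z.2) ->
  \int[m1]_x \int[m2]_y F x y = \int[m2]_y \int[m1]_x F x y.
Proof.
by move=> F0 mF; exact: (fubini_tonelli (fun z => F z.1 z.2)).
Qed.

Lemma tonelli_prod (F : S * T -> \bar R) :
  (forall z, 0 <= F z) -> measurable_fun setT F ->
  \int[m1 \x m2]_z F z = \int[m1]_x \int[m2]_y F (x, y).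
Proof. by move=> F0 mF; rewrite fubini_tonelli1. Qed.

End tonelli.

(* The library's canonical sigma-finite structure on [m1 \x m2] only covers
   subprobability measures. *)
Section sigma_finite_product.
Context d1 d2 (S : measurableType d1) (T : measurableType d2) (R : realType).
Variables (m1 : {sigma_finite_measure set S -> \bar R}).
Variables (m2 : {sigma_finite_measure set T -> \bar R}).
Local Open Scope ereal_scope.

Definition sfprod : set (S * T) -> \bar R := m1 \x m2.

Let sfprod0 : sfprod set0 = 0. Proof. exact: measure0. Qed.
Let sfprod_ge0 A : 0 <= sfprod A. Proof. exact: measure_ge0. Qed.
Let sfprod_sigma_additive : semi_sigma_additive sfprod.
Proof. exact: measure_semi_sigma_additive. Qed.

HB.instance Definition _ := isMeasure.Build _ _ _
  sfprod sfprod0 sfprod_ge0 sfprod_sigma_additive.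

Let sfprod_sigma_finite : sigma_finite setT sfprod.
Proof.
have /sigma_finiteP[F [TF ndF Foo]] := sigma_finiteT m1.
have /sigma_finiteP[G [TG ndG Goo]] := sigma_finiteT m2.
exists (fun k => F k `*` G k).
  rewrite predeqE => -[x y]; split=> // _.
  have [i _ Fi] : (\bigcup_i F i) x by rewrite -TF.
  have [j _ Gj] : (\bigcup_i G i) y by rewrite -TG.
  exists (maxn i j) => //; split.
    by have /subsetPset := ndF _ _ (leq_maxl i j); exact.
  by have /subsetPset := ndG _ _ (leq_maxr i j); exact.
move=> k; have [mF Fk] := Foo k; have [mG Gk] := Goo k; split.
  exact: measurableX.
by rewrite /sfprod product_measure1E// lte_mul_pinfty// ge0_fin_numE.
Qed.

HB.instance Definition _ := Measure_isSigmaFinite.Build _ _ _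
  sfprod sfprod_sigma_finite.
End sigma_finite_product.

(** * Tuples split into one coordinate and the rest *)

Definition insert_at (T : Type) m (i : 'I_m.+1) (z : T) (t : m.-tuple T) :
    m.+1.-tuple T :=
  [tuple if unlift i k is Some l then tnth t l else z | k < m.+1].

Lemma tnth_insert_at (T : Type) m (i : 'I_m.+1) (z : T) (t : m.-tuple T) :
  tnth (insert_at i z t) i = z.
Proof. by rewrite tnth_mktuple unlift_none. Qed.

Lemma tnth_insert_at_lift (T : Type) m (i : 'I_m.+1) (z : T) (t : m.-tuple T) l :
  tnth (insert_at i z t) (lift i l) = tnth t l.
Proof. by rewrite tnth_mktuple liftK. Qed.

Lemma subst_at_insert_at (T : Type) m (i : 'I_m.+1) (z y : T) (t : m.-tuple T) :
  subst_at (insert_at i z t) i y = insert_at i y t.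
Proof.
apply: eq_from_tnth => k; rewrite !tnth_mktuple.
by case: unliftP => [l ->|->]; rewrite ?eqxx// eq_sym (negbTE (neq_lift _ _)).
Qed.

Lemma drop_at_insert_at (T : Type) m (i : 'I_m.+1) (z : T) (t : m.-tuple T) :
  drop_at (insert_at i z t) i = t.
Proof. by apply: eq_from_tnth => k; rewrite !tnth_mktuple liftK. Qed.

Lemma insert_at0 (T : Type) m (z : T) (t : m.-tuple T) :
  insert_at ord0 z t = [tuple of z :: t].
Proof.
apply: eq_from_tnth => k; rewrite tnth_mktuple.
by case: unliftP => [l ->|->]; rewrite ?tnthS// tnth0.
Qed.

(** Insertion behind the head only touches the tail. This matches the construction of
    [tuple_measure] by adding heads and serves as the inductive step when a later coordinate is
    integrated out. *)
Lemma insert_at_lift (T : Type) m (i : 'I_m.+1) (z x0 : T) (t : m.-tuple T) :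
  insert_at (lift ord0 i) z [tuple of x0 :: t] = [tuple of x0 :: insert_at i z t].
Proof.
apply: eq_from_tnth => k; have [l ->|->] := unliftP ord0 k; last first.
  rewrite [RHS]tnth0 -[RHS](tnth0 x0 t) -(tnth_insert_at_lift (lift ord0 i) z).
  by congr tnth; apply/val_inj.
have [j ->|->] := unliftP i l.
  rewrite tnthS tnth_insert_at_lift.
  have -> : lift ord0 (lift i j) = lift (lift ord0 i) (lift ord0 j).
    by apply/val_inj; rewrite /= /bump /= !add1n ltnS addnS.
  by rewrite tnth_insert_at_lift tnthS.
by rewrite tnth_insert_at tnthS tnth_insert_at.
Qed.

Section measurable_tuple_ops.
Context d d' (S : measurableType d') (T : measurableType d).

Lemma measurable_fun_tnth n (i : 'I_n) (f : S -> n.-tuple T) :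
  measurable_fun setT f -> measurable_fun setT (fun x => tnth (f x) i).
Proof. by move=> mf; apply/(measurable_fun_tnthP f).1. Qed.

Lemma measurable_insert_at m (i : 'I_m.+1) (f : S -> T) (g : S -> m.-tuple T) :
  measurable_fun setT f -> measurable_fun setT g ->
  measurable_fun setT (fun x => insert_at i (f x) (g x)).
Proof.
move=> mf mg; apply/measurable_fun_tnthP => k.
rewrite (_ : _ \o _ = fun x => if unlift i k is Some l then tnth (g x) l else f x).
  by case: unliftP => // l _; exact: measurable_fun_tnth.
by apply/funext => x /=; rewrite tnth_mktuple.
Qed.

Lemma measurable_subst_at n (i : 'I_n) (f : S -> T) (g : S -> n.-tuple T) :
  measurable_fun setT f -> measurable_fun setT g ->
  measurable_fun setT (fun x => subst_at (g x) i (f x)).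
Proof.
move=> mf mg; apply/measurable_fun_tnthP => k.
rewrite (_ : _ \o _ = fun x => if k == i then f x else tnth (g x) k).
  by case: eqP => // _; exact: measurable_fun_tnth.
by apply/funext => x /=; rewrite tnth_mktuple.
Qed.

Lemma measurable_drop_at n (i : 'I_n) (g : S -> n.-tuple T) :
  measurable_fun setT g -> measurable_fun setT (fun x => drop_at (g x) i).
Proof.
move=> mg; apply/measurable_fun_tnthP => k.
rewrite (_ : _ \o _ = fun x => tnth (g x) (lift i k)).
  exact: measurable_fun_tnth.
by apply/funext => x /=; rewrite tnth_mktuple.
Qed.
End measurable_tuple_ops.

Section tuple_measure_integral.
Context d (T : measurableType d) (R : realType).
Variable mu : {sigma_finite_measure set T -> \bar R}.
Local Open Scope ereal_scope.

Lemma ge0_integral_tuple_measureS m (F : m.+1.-tuple T -> \bar R) :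
  (forall x, 0 <= F x) -> measurable_fun setT F ->
  \int[tuple_measure mu m.+1]_x F x =
  \int[mu]_z \int[tuple_measure mu m]_t F [tuple of z :: t].
Proof.
move=> F0 mF; rewrite /= /tcons_measure.
rewrite ge0_integral_pushforward//=; last exact: measurable_tcons.
rewrite preimage_setT tonelli_prod//.
by apply: measurableT_comp => //; exact: measurable_tcons.
Qed.

(** Induction on the length: position 0 is Tonelli for head and tail; at a later position the head
    is kept and the induction hypothesis applies to the tail. *)
Lemma ge0_integral_insert_at m (i : 'I_m.+1) (F : m.+1.-tuple T -> \bar R) :
  (forall x, 0 <= F x) -> measurable_fun setT F ->
  \int[tuple_measure mu m.+1]_x F x =
  \int[tuple_measure mu m]_t \int[mu]_z F (insert_at i z t).
Proof.
move=> F0 mF; elim: m i F F0 mF => [|m IH] i F F0 mF;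
  rewrite ge0_integral_tuple_measureS//.
  apply: etrans (tonelli_swap mu _ _ _) _.
  - by move=> z t; exact: F0.
  - by apply: (measurableT_comp mF); exact: measurable_cons.
  by apply: eq_integral => t _; apply: eq_integral => z _; rewrite ord1 insert_at0.
have [k ->|->] := unliftP ord0 i; last first.
  apply: etrans (tonelli_swap mu _ _ _) _.
  - by move=> z t; exact: F0.
  - by apply: (measurableT_comp mF); exact: measurable_cons.
  by apply: eq_integral => t _; apply: eq_integral => z _; rewrite insert_at0.
rewrite ge0_integral_tuple_measureS//; last 2 first.
- by move=> t; exact: integral_ge0.
- apply: measurable_int_r => //=; apply: measurableT_comp => //.
  exact: measurable_insert_at.
apply: eq_integral => z _; apply: etrans (IH k _ _ _) _.
- by move=> t; exact: F0.
- by apply: (measurableT_comp mF); exact: measurable_cons.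
apply: eq_integral => t _; apply: eq_integral => y _.
by rewrite insert_at_lift.
Qed.

(** Once [insert_at] has singled out x_i, both x_i and [y] range over [mu] with the other
    coordinates fixed, so Tonelli may swap their roles. *)
Lemma ge0_integral_exchange n (i : 'I_n) (H : n.-tuple T -> T -> \bar R) :
  (forall x y, 0 <= H x y) ->
  measurable_fun [set: n.-tuple T * T] (fun z => H z.1 z.2) ->
  \int[tuple_measure mu n]_x \int[mu]_y H x y =
  \int[tuple_measure mu n]_x \int[mu]_y H (subst_at x i y) (tnth x i).
Proof.
case: n i H => [[]//|m] i H H0 mH.
rewrite (ge0_integral_insert_at i); last 2 first.
- by move=> t; exact: integral_ge0.
- exact: measurable_int_r.
rewrite [RHS](ge0_integral_insert_at i); last 2 first.
- by move=> t; exact: integral_ge0.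
- apply: measurable_int_r => //.
  apply: (measurableT_comp mH (g := fun z => (subst_at z.1 i z.2, tnth z.1 i))).
  apply: measurable_fun_pair => /=; first exact: measurable_subst_at.
  exact: measurable_fun_tnth.
apply: eq_integral => t _; apply: etrans (tonelli_swap mu mu _ _) _.
- by move=> z y; exact: H0.
- apply: (measurableT_comp mH (g := fun z => (insert_at i z.1 t, z.2))).
  apply: measurable_fun_pair => //=; exact: measurable_insert_at.
apply: eq_integral => z _; apply: eq_integral => y _.
by rewrite subst_at_insert_at tnth_insert_at.
Qed.

End tuple_measure_integral.

(** * Bounded operators on L^1 *)

Section L1fun_facts.
Context d (T : measurableType d) (R : realType).
Variable mu : {measure set T -> \bar R}.
Local Open Scope ereal_scope.

Lemma Lfun1P (f : T -> R) : f \in Lfun mu 1 <->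
  measurable_fun setT f /\ \int[mu]_x `|f x|%:E < +oo.
Proof.
rewrite Lfun1_integrable; split.
  by move=> /integrableP[/measurable_EFinP mf fi]; split; last exact: fi.
move=> [mf fi]; apply/integrableP; split; first exact/measurable_EFinP.
exact: fi.
Qed.

Lemma ge0_integral_lty_ae (f : T -> \bar R) : (forall x, 0 <= f x) ->
  measurable_fun setT f -> \int[mu]_x f x < +oo ->
  \forall x \ae mu, f x < +oo.
Proof.
move=> f0 mf fi; have : mu.-integrable setT f.
  by apply/integrableP; split=> //; rewrite (eq_integral f)// => x _; rewrite gee0_abs.
by move=> /integrable_ae -/(_ measurableT); apply: filterS => x /(_ I);
  rewrite ge0_fin_numE.
Qed.

Lemma ge0_integral_eq0_ae (f : T -> \bar R) : (forall x, 0 <= f x) ->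
  measurable_fun setT f -> \int[mu]_x f x = 0 ->
  \forall x \ae mu, f x = 0.
Proof.
move=> f0 mf fi; have : \int[mu]_x `|f x| = 0.
  by rewrite (eq_integral f)// => x _; rewrite gee0_abs.
by move=> /ae_eq_integral_abs -/(_ measurableT mf); apply: filterS => x /(_ I).
Qed.

End L1fun_facts.

Section L1bounded.
Context d1 d2 (S : measurableType d1) (T : measurableType d2) (R : realType).
Variables (mu : {measure set S -> \bar R}) (nu : {measure set T -> \bar R}).
Local Open Scope ereal_scope.

(** The bound concerns functions because [L0_fun] and [W_fun] act on functions. With [maps_L1]
    included it passes to classes, since the default value 0 of [L1map] is then never taken. *)
Definition L1bounded (F : (S -> R) -> T -> R) (M : R) :=
  [/\ (0 <= M)%R, maps_L1 mu nu F & forall f, f \in Lfun mu 1 ->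
    \int[nu]_x `|F f x|%:E <= M%:E * \int[mu]_x `|f x|%:E].

Lemma L1bounded0 : L1bounded (fun _ _ => 0%R) 0.
Proof.
split => //; last first.
  move=> f _; rewrite mul0e (eq_integral (cst 0)) ?integral0// => x _.
  by rewrite normr0.
split=> [f _|f g _ _ _]; last exact/nearW.
apply/Lfun1P; split=> //; rewrite (eq_integral (cst 0)) ?integral0// => x _.
by rewrite normr0.
Qed.

Lemma L1boundedD F G M N : L1bounded F M -> L1bounded G N ->
  L1bounded (fun f x => F f x + G f x)%R (M + N).
Proof.
move=> [M0 [F1 F2] F3] [N0 [G1 G2] G3].
have FGle f : f \in Lfun mu 1 -> \int[nu]_x `|(F f x + G f x)%R|%:E <=
    (M + N)%:E * \int[mu]_x `|f x|%:E.
  move=> Lf; have /Lfun1P[mF _] := F1 _ Lf; have /Lfun1P[mG _] := G1 _ Lf.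
  apply: (@le_trans _ _ (\int[nu]_x (`|F f x|%:E + `|G f x|%:E))).
    apply: ge0_le_integral => //.
    - by apply/measurable_EFinP/measurableT_comp => //; exact: measurable_funD.
    - by apply: emeasurable_funD; exact/measurable_EFinP/measurableT_comp.
    - by move=> x _; rewrite -EFinD lee_fin ler_normD.
  rewrite ge0_integralD//; last 2 first.
  - exact/measurable_EFinP/measurableT_comp.
  - exact/measurable_EFinP/measurableT_comp.
  rewrite EFinD ge0_muleDl ?lee_fin//.
  by apply: leeD; [exact: F3|exact: G3].
split => //; first exact: addr_ge0.
split=> [f Lf|f g Lf Lg fg].
  apply/Lfun1P; split.
    have /Lfun1P[mF _] := F1 _ Lf; have /Lfun1P[mG _] := G1 _ Lf.
    exact: measurable_funD.
  apply: (le_lt_trans (FGle _ Lf)).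
  by have /Lfun1P[_ fy] := Lf; rewrite lte_mul_pinfty// lee_fin addr_ge0.
by apply: filterS2 (F2 _ _ Lf Lg fg) (G2 _ _ Lf Lg fg) => x Fx Gx _;
  rewrite Fx ?Gx.
Qed.

Lemma eq_L1bounded F G M N : (forall f x, F f x = G f x) -> M = N ->
  L1bounded F M -> L1bounded G N.
Proof.
move=> FG <-; rewrite (_ : F = G)//.
by apply/funext => f; apply/funext => x.
Qed.

Lemma L1bounded_sum (I : Type) (r : seq I) (P : pred I)
    (F : I -> (S -> R) -> T -> R) (M : I -> R) :
  (forall i, P i -> L1bounded (F i) (M i)) ->
  L1bounded (fun f x => \sum_(i <- r | P i) F i f x)%R (\sum_(i <- r | P i) M i)%R.
Proof.
move=> FM; elim: r => [|i r IH].
  apply: eq_L1bounded L1bounded0; last by rewrite big_nil.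
  by move=> f x; rewrite big_nil.
have [Pi|nPi] := boolP (P i); last first.
  apply: eq_L1bounded IH; last by rewrite big_cons (negbTE nPi).
  by move=> f x; rewrite big_cons (negbTE nPi).
apply: eq_L1bounded (L1boundedD (FM i Pi) IH); last by rewrite big_cons Pi.
by move=> f x; rewrite big_cons Pi.
Qed.

Lemma L1bounded_norm F M (u : L1space mu) : L1bounded F M ->
  (`|L1map mu nu F u| <= M * `|u|)%R.
Proof.
move=> [M0 LF Fle]; rewrite -(L1reprK u); set f := L1repr u.
have Lf : (f : S -> R) \in Lfun mu 1 by exact: LfunP.
rewrite (L1map_class (LF.1 f Lf) LF) -lee_fin EFinM !L1normP !Lnorm1.
exact: Fle.
Qed.

End L1bounded.

(** * Integral operators with a gain and a loss term *)

Section kernel_operator.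
Context d1 d2 d3 (S : measurableType d1) (T : measurableType d2)
  (Y : measurableType d3) (R : realType).
Variables (mu : {measure set S -> \bar R}).
Variables (nu : {measure set T -> \bar R}).
Variables (eta : {sigma_finite_measure set Y -> \bar R}).
Local Open Scope ereal_scope.
Variables (K : T -> Y -> \bar R) (phi : T -> Y -> S) (psi : T -> S).
Variables (A B : R).
Hypotheses (A0 : (0 <= A)%R) (B0 : (0 <= B)%R).
Hypothesis K0 : forall x y, 0 <= K x y.
Hypothesis mK : measurable_fun [set: T * Y] (fun z => K z.1 z.2).
Hypothesis mphi : measurable_fun [set: T * Y] (fun z => phi z.1 z.2).
Hypothesis mpsi : measurable_fun [set: T] psi.
Hypothesis phiA : forall f : S -> \bar R, (forall x, 0 <= f x) ->
  measurable_fun setT f ->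
  \int[nu]_x \int[eta]_y (K x y * f (phi x y)) <= A%:E * \int[mu]_x f x.
Hypothesis psiB : forall f : S -> \bar R, (forall x, 0 <= f x) ->
  measurable_fun setT f ->
  \int[nu]_x \int[eta]_y (K x y * f (psi x)) <= B%:E * \int[mu]_x f x.

(** A summand of [L0_fun] is the case where [K] is [rate_at], [phi] is [jump] and [psi] the
    identity; a summand of [W_fun] is the case of [rate1_at], [hop] and the deletion of a
    coordinate. Since [fine] sends an infinite integral to 0, the convention for divergence is the
    same on both sides and the unfolding is by conversion. *)
Definition kernel_op (f : S -> R) (x : T) : R :=
  fine (\int[eta]_y (K x y * (f (phi x y) - f (psi x))%:E)).

Lemma measurable_kernel_mul (f : S -> \bar R) : measurable_fun setT f ->
  measurable_fun [set: T * Y] (fun z => K z.1 z.2 * f (phi z.1 z.2)).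
Proof.
by move=> mf; apply: emeasurable_funM => //; exact: (measurableT_comp mf mphi).
Qed.

Lemma measurable_kernel_mul_psi (f : S -> \bar R) : measurable_fun setT f ->
  measurable_fun [set: T * Y] (fun z => K z.1 z.2 * f (psi z.1)).
Proof.
move=> mf; apply: emeasurable_funM => //.
exact: (measurableT_comp mf (measurableT_comp mpsi measurable_fst)).
Qed.

Lemma measurable_kernel_integrand (f : S -> R) : measurable_fun setT f ->
  measurable_fun [set: T * Y]
    (fun z => K z.1 z.2 * (f (phi z.1 z.2) - f (psi z.1))%:E).
Proof.
move=> mf; apply: emeasurable_funM => //; apply/measurable_EFinP.
apply: measurable_funB; first exact: (measurableT_comp mf mphi).
exact: (measurableT_comp mf (measurableT_comp mpsi measurable_fst)).
Qed.

Lemma measurable_kernel_op f : measurable_fun setT f ->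
  measurable_fun setT (kernel_op f).
Proof.
move=> mf; apply: measurable_int_r_fine; exact: measurable_kernel_integrand.
Qed.

Lemma measurable_section (F : T -> Y -> \bar R) x :
  measurable_fun [set: T * Y] (fun z => F z.1 z.2) -> measurable_fun setT (F x).
Proof. by move=> mF; exact: (measurableT_comp mF (pair1_measurable x)). Qed.

Lemma kernel_phi_lty f : f \in Lfun mu 1 ->
  \forall x \ae nu, \int[eta]_y (K x y * `|f (phi x y)|%:E) < +oo.
Proof.
move=> /Lfun1P[mf fi].
have mf' : measurable_fun setT (fun x => `|f x|%:E).
  exact/measurable_EFinP/measurableT_comp.
apply: ge0_integral_lty_ae.
- by move=> x; apply: integral_ge0 => y _; rewrite mule_ge0.
- apply: measurable_int_r => [x y|]; first by rewrite mule_ge0.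
  exact: (measurable_kernel_mul mf').
- apply: (le_lt_trans (phiA _ mf')) => //.
  by rewrite lte_mul_pinfty.
Qed.

Lemma kernel_psi_lty f : f \in Lfun mu 1 ->
  \forall x \ae nu, \int[eta]_y (K x y * `|f (psi x)|%:E) < +oo.
Proof.
move=> /Lfun1P[mf fi].
have mf' : measurable_fun setT (fun x => `|f x|%:E).
  exact/measurable_EFinP/measurableT_comp.
apply: ge0_integral_lty_ae.
- by move=> x; apply: integral_ge0 => y _; rewrite mule_ge0.
- apply: measurable_int_r => [x y|]; first by rewrite mule_ge0.
  exact: (measurable_kernel_mul_psi mf').
- apply: (le_lt_trans (psiB _ mf')) => //.
  by rewrite lte_mul_pinfty.
Qed.

Lemma kernel_integrand_abs_le (f : S -> R) x : measurable_fun setT f ->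
  \int[eta]_y `|K x y * (f (phi x y) - f (psi x))%:E| <=
  \int[eta]_y (K x y * `|f (phi x y)|%:E) + \int[eta]_y (K x y * `|f (psi x)|%:E).
Proof.
move=> mf.
have mf' : measurable_fun setT (fun x => `|f x|%:E).
  exact/measurable_EFinP/measurableT_comp.
rewrite -ge0_integralD//; last 4 first.
- by move=> y _; rewrite mule_ge0.
- exact: (measurable_section (F := fun x y => K x y * `|f (phi x y)|%:E) x
    (measurable_kernel_mul mf')).
- by move=> y _; rewrite mule_ge0.
- exact: (measurable_section (F := fun x y => K x y * `|f (psi x)|%:E) x
    (measurable_kernel_mul_psi mf')).
apply: ge0_le_integral => //.
- apply: measurableT_comp => //.
  exact: (measurable_section (F := fun x y => K x y * (f (phi x y) - f (psi x))%:E) x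
    (measurable_kernel_integrand mf)).
- apply: emeasurable_funD.
    exact: (measurable_section (F := fun x y => K x y * `|f (phi x y)|%:E) x
      (measurable_kernel_mul mf')).
  exact: (measurable_section (F := fun x y => K x y * `|f (psi x)|%:E) x
    (measurable_kernel_mul_psi mf')).
- move=> y _; rewrite abseM (gee0_abs (K0 _ _)) -ge0_muleDr//.
  by apply: lee_wpmul2l => //; rewrite -EFinD abse_EFin lee_fin ler_normB.
Qed.

Lemma kernel_integrable f : f \in Lfun mu 1 ->
  \forall x \ae nu,
    eta.-integrable setT (fun y => K x y * (f (phi x y) - f (psi x))%:E).
Proof.
move=> Lf; have /Lfun1P[mf _] := Lf.
apply: filterS2 (kernel_phi_lty Lf) (kernel_psi_lty Lf) => x phix psix.
apply/integrableP; split.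
  exact: (measurable_section (F := fun x y => K x y * (f (phi x y) - f (psi x))%:E) x
    (measurable_kernel_integrand mf)).
by rewrite (le_lt_trans (kernel_integrand_abs_le _ mf))// lte_add_pinfty.
Qed.

Lemma kernel_op_abs_le (f : S -> R) x : measurable_fun setT f ->
  `|kernel_op f x|%:E <= \int[eta]_y (K x y * `|f (phi x y)|%:E) +
    \int[eta]_y (K x y * `|f (psi x)|%:E).
Proof.
move=> mf; apply: (le_trans _ (kernel_integrand_abs_le x mf)).
apply: (le_trans _ (le_abse_integral _ _ _)) => //; last first.
  exact: (measurable_section (F := fun x y => K x y * (f (phi x y) - f (psi x))%:E) x
    (measurable_kernel_integrand mf)).
(* If the integral is infinite, its [fine] is 0 and the bound is trivial. *)
by rewrite /kernel_op; case: (\int[eta]_y _) => //=; rewrite normr0 leey.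
Qed.

Lemma kernel_op_le (f : S -> R) : measurable_fun setT f ->
  \int[nu]_x `|kernel_op f x|%:E <= (A + B)%:E * \int[mu]_x `|f x|%:E.
Proof.
move=> mf.
have mf' : measurable_fun setT (fun x => `|f x|%:E).
  exact/measurable_EFinP/measurableT_comp.
have m1 : measurable_fun setT (fun x => \int[eta]_y (K x y * `|f (phi x y)|%:E)).
  apply: measurable_int_r => [x y|]; first by rewrite mule_ge0.
  exact: (measurable_kernel_mul mf').
have m2 : measurable_fun setT (fun x => \int[eta]_y (K x y * `|f (psi x)|%:E)).
  apply: measurable_int_r => [x y|]; first by rewrite mule_ge0.
  exact: (measurable_kernel_mul_psi mf').
apply: (@le_trans _ _ (\int[nu]_x (\int[eta]_y (K x y * `|f (phi x y)|%:E) +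
    \int[eta]_y (K x y * `|f (psi x)|%:E)))).
  apply: ge0_le_integral => //.
  - by apply/measurable_EFinP/measurableT_comp => //; exact: measurable_kernel_op.
  - exact: emeasurable_funD.
  - by move=> x _; exact: kernel_op_abs_le.
rewrite ge0_integralD//; last 2 first.
- by move=> x _; apply: integral_ge0 => y _; rewrite mule_ge0.
- by move=> x _; apply: integral_ge0 => y _; rewrite mule_ge0.
rewrite EFinD ge0_muleDl ?lee_fin//.
by apply: leeD; [exact: phiA|exact: psiB].
Qed.

(** [phi] may send a set of positive measure into a null set, but [K] vanishes a.e. on it: applied
    to |f - g|, the bounds [phiA] and [psiB] show that for a.e. [x] the products of [K x y] with |f
    - g| at [phi x y] and at [psi x] vanish for a.e. [y]. *)
Lemma kernel_op_ae (f g : S -> R) : measurable_fun setT f -> measurable_fun setT g ->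
  f = g %[ae mu] -> kernel_op f = kernel_op g %[ae nu].
Proof.
move=> mf mg fg; pose h x := `|f x - g x|%:E.
have mh : measurable_fun setT h.
  by apply/measurable_EFinP/measurableT_comp => //; exact: measurable_funB.
have h0 x : 0 <= h x by rewrite lee_fin.
have ih : \int[mu]_x h x = 0.
  rewrite (ge0_ae_eq_integral _ mh (g := cst 0)) ?integral0//.
  by apply: filterS fg => x fgx _; rewrite /h fgx// subrr normr0.
have mphi' := measurable_kernel_mul mh.
have mpsi' := measurable_kernel_mul_psi mh.
have phi0 : \forall x \ae nu, \int[eta]_y (K x y * h (phi x y)) = 0.
  apply: ge0_integral_eq0_ae.
  - by move=> x; apply: integral_ge0 => y _; rewrite mule_ge0.
  - by apply: measurable_int_r => [x y|//]; rewrite mule_ge0.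
  - apply/eqP; rewrite eq_le; apply/andP; split.
      by rewrite (le_trans (phiA h0 mh))// ih mule0.
    by apply: integral_ge0 => x _; apply: integral_ge0 => y _; rewrite mule_ge0.
have psi0 : \forall x \ae nu, \int[eta]_y (K x y * h (psi x)) = 0.
  apply: ge0_integral_eq0_ae.
  - by move=> x; apply: integral_ge0 => y _; rewrite mule_ge0.
  - by apply: measurable_int_r => [x y|//]; rewrite mule_ge0.
  - apply/eqP; rewrite eq_le; apply/andP; split.
      by rewrite (le_trans (psiB h0 mh))// ih mule0.
    by apply: integral_ge0 => x _; apply: integral_ge0 => y _; rewrite mule_ge0.
apply: filterS2 phi0 psi0 => x phix psix _.
have {}phix : \forall y \ae eta, K x y * h (phi x y) = 0.
  apply: ge0_integral_eq0_ae => //; first by move=> y; rewrite mule_ge0.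
  exact: (measurable_section (F := fun x y => K x y * h (phi x y)) x).
have {}psix : \forall y \ae eta, K x y * h (psi x) = 0.
  apply: ge0_integral_eq0_ae => //; first by move=> y; rewrite mule_ge0.
  exact: (measurable_section (F := fun x y => K x y * h (psi x)) x).
congr fine; apply: ae_eq_integral => //.
- exact: (measurable_section (F := fun x y => K x y * (f (phi x y) - f (psi x))%:E) x
    (measurable_kernel_integrand mf)).
- exact: (measurable_section (F := fun x y => K x y * (g (phi x y) - g (psi x))%:E) x
    (measurable_kernel_integrand mg)).
have h0P z : h z = 0 -> f z = g z.
  by move=> /eqP; rewrite eqe normr_eq0 subr_eq0 => /eqP.
apply: filterS2 phix psix => y /eqP + /eqP + _.
(* Where [K] is 0 both integrands are 0, whatever [f] and [g] are; elsewhere [f] and [g] agree at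
   both arguments. *)
rewrite !mule_eq0; have [->|K_neq0] := eqVneq (K x y) 0; first by rewrite !mul0e.
by rewrite /= => /eqP/h0P -> /eqP/h0P ->.
Qed.

Lemma kernel_op_L1bounded : L1bounded mu nu kernel_op (A + B).
Proof.
split; first exact: addr_ge0.
  split=> [f /Lfun1P[mf fi]|f g /Lfun1P[mf _] /Lfun1P[mg _]]; last exact: kernel_op_ae.
  apply/Lfun1P; split; first exact: measurable_kernel_op.
  by rewrite (le_lt_trans (kernel_op_le mf))// lte_mul_pinfty// lee_fin addr_ge0.
by move=> f /Lfun1P[mf _]; exact: kernel_op_le.
Qed.

(** Only a.e., because the default value 0 of a divergent integral breaks additivity;
    [kernel_integrable] rules out divergence for a.e. [x]. *)
Lemma kernel_op_linear (a : R) (f g : S -> R) : (forall x y, K x y \is a fin_num) ->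
  f \in Lfun mu 1 -> g \in Lfun mu 1 ->
  \forall x \ae nu, kernel_op (fun z => a * f z + g z)%R x =
    (a * kernel_op f x + kernel_op g x)%R.
Proof.
move=> Kfin Lf Lg; apply: filterS2 (kernel_integrable Lf) (kernel_integrable Lg).
move=> x If Ig; rewrite /kernel_op.
rewrite (eq_integral (fun y => a%:E * (K x y * (f (phi x y) - f (psi x))%:E) +
    K x y * (g (phi x y) - g (psi x))%:E)); last first.
  move=> y _; rewrite -(fineK (Kfin x y)) -!EFinM -EFinD; congr EFin.
  by ring.
rewrite integralD//; last exact: integrableZl.
rewrite integralZl// fineD ?fineM//.
- by apply: integrable_fin_num.
- by rewrite fin_numM//; exact: integrable_fin_num.
- by apply: integrable_fin_num.
Qed.

(** Of the gain [J] only the size will matter. The loss is kept exact, so that its coefficient can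
    be combined with that of the identity in 1 + h L_0. *)
Lemma kernel_op_split (f : S -> R) x : (forall y, K x y \is a fin_num) ->
  measurable_fun setT f ->
  \int[eta]_y (K x y * `|f (phi x y)|%:E) < +oo -> \int[eta]_y K x y < +oo ->
  exists2 J : R, kernel_op f x = (J - fine (\int[eta]_y K x y) * f (psi x))%R &
    (`|J| <= fine (\int[eta]_y (K x y * `|f (phi x y)|%:E)))%R.
Proof.
move=> Kfin mf phiy Ky.
have mKx : measurable_fun setT (K x) by exact: measurable_section.
have mfE : measurable_fun setT (EFin \o f) by exact/measurable_EFinP.
have mKf : measurable_fun setT (fun y => K x y * (f (phi x y))%:E).
  exact: (measurable_section (F := fun x y => K x y * (f (phi x y))%:E) x
    (measurable_kernel_mul mfE)).
have absE y : `|K x y * (f (phi x y))%:E| = K x y * `|f (phi x y)|%:E.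
  by rewrite abseM gee0_abs.
have IK : eta.-integrable setT (K x).
  apply/integrableP; split=> //; rewrite (eq_integral (K x))// => y _.
  by rewrite gee0_abs.
have IKf : eta.-integrable setT (fun y => K x y * (f (phi x y))%:E).
  apply/integrableP; split=> //.
  by rewrite (eq_integral (fun y => K x y * `|f (phi x y)|%:E)).
exists (fine (\int[eta]_y (K x y * (f (phi x y))%:E))).
  rewrite /kernel_op (eq_integral (fun y => K x y * (f (phi x y))%:E -
      (f (psi x))%:E * K x y)); last first.
    move=> y _; rewrite -(fineK (Kfin y)) -!EFinM -EFinB; congr EFin.
    by ring.
  rewrite integralB//; last exact: integrableZl.
  rewrite integralZl// fineB ?fineM//.
  - by rewrite mulrC.
  - exact: integrable_fin_num.
  - exact: integrable_fin_num.
  - by rewrite fin_numM//; exact: integrable_fin_num.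
rewrite -lee_fin fineK; last first.
  by rewrite ge0_fin_numE//; apply: integral_ge0 => y _; rewrite mule_ge0.
rewrite -abse_EFin fineK; last exact: integrable_fin_num.
rewrite (le_trans (le_abse_integral _ _ _))//.
by rewrite (eq_integral (fun y => K x y * `|f (phi x y)|%:E)).
Qed.

End kernel_operator.

(** * Integrals of the rate *)

Lemma subst_at_idem (T : Type) n (x : n.-tuple T) i (y z : T) :
  subst_at (subst_at x i y) i z = subst_at x i z.
Proof. by apply: eq_from_tnth => k; rewrite !tnth_mktuple; case: eqP. Qed.

Lemma subst_at_tnth (T : Type) n (x : n.-tuple T) i :
  subst_at x i (tnth x i) = x.
Proof. by apply: eq_from_tnth => k; rewrite !tnth_mktuple; case: eqP => [->|]. Qed.

Lemma tnth_subst_at (T : Type) n (x : n.-tuple T) i (y : T) k :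
  tnth (subst_at x i y) k = if k == i then y else tnth x k.
Proof. by rewrite tnth_mktuple. Qed.

Section tuple_measure_ae.
Context d (T : measurableType d) (R : realType).
Variable mu : {sigma_finite_measure set T -> \bar R}.
Local Open Scope ereal_scope.

Lemma tuple_measure_gt0 n : 0 < mu setT -> 0 < tuple_measure mu n setT.
Proof.
move=> mu0; elim: n => [|n IH]; first by rewrite /= diracT lte01.
rewrite /= /tcons_measure /pushforward preimage_setT -setXTT.
by rewrite product_measure1E// mule_gt0.
Qed.

Lemma prod_measure_gt0 : 0 < mu setT -> 0 < (mu \x mu) setT.
Proof. by move=> mu0; rewrite -setXTT product_measure1E// mule_gt0. Qed.

Lemma measure_indic_integral d' (S : measurableType d')
    (nu : {measure set S -> \bar R}) (N : set S) : measurable N ->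
  nu N = \int[nu]_x (\1_N x)%:E.
Proof. by move=> mN; rewrite integral_indic// setIT. Qed.

Lemma indic_preimage (S V : Type) (g : S -> V) (N : set V) x :
  \1_(g @^-1` N) x = \1_N (g x) :> R.
Proof. by rewrite !indicE; congr (_%:R); apply/idP/idP; rewrite !inE. Qed.

(** A coordinate map need not push the measure on tuples to [mu], yet it pulls null sets back to
    null sets: with x_i singled out, the inner integral is [mu N], which is 0. *)
Lemma ae_tnth n (i : 'I_n) (P : T -> Prop) :
  (\forall z \ae mu, P z) -> \forall x \ae tuple_measure mu n, P (tnth x i).
Proof.
case: n i => [[]//|m] i [N [mN N0 PN]].
have mtN : measurable ((fun x : m.+1.-tuple T => tnth x i) @^-1` N).
  by rewrite -[_ @^-1` _]setTI; exact: measurable_tnth.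
exists ((fun x => tnth x i) @^-1` N); split => //; last by move=> x /= /PN.
rewrite (measure_indic_integral _ mtN) (ge0_integral_insert_at mu i)//; last first.
  exact/measurable_EFinP/measurable_indic.
rewrite (eq_integral (cst 0)) ?integral0// => t _.
rewrite -N0 (measure_indic_integral _ mN); apply: eq_integral => z _.
by rewrite indic_preimage tnth_insert_at.
Qed.

(** Singling out [i] and then [j] leaves the product measure of [N] as inner double integral. For
    equal indices the pair would run through the diagonal, which may itself be null. *)
Lemma ae_tnth2 n (i j : 'I_n) (P : T * T -> Prop) : i != j ->
  (\forall z \ae (mu \x mu), P z) ->
  \forall x \ae tuple_measure mu n, P (tnth x i, tnth x j).
Proof.
case: n i j => [[]//|m] i j ij [N [mN N0 PN]].
have mij : measurable_fun setT (fun x : m.+1.-tuple T => (tnth x i, tnth x j)).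
  by apply: measurable_fun_pair; exact: measurable_tnth.
have mtN : measurable ((fun x : m.+1.-tuple T => (tnth x i, tnth x j)) @^-1` N).
  by rewrite -[_ @^-1` _]setTI; exact: mij.
exists ((fun x => (tnth x i, tnth x j)) @^-1` N); split => //; last by move=> x /= /PN.
rewrite (measure_indic_integral _ mtN) (ge0_integral_insert_at mu i)//; last first.
  exact/measurable_EFinP/measurable_indic.
have [l jl|jE] := unliftP i j; last by rewrite jE eqxx in ij.
(* A tuple of length 1 has no second coordinate: [l] would be an element of the empty type
   ['I_0]. *)
case: m i j ij mij mtN l jl => [|m] i j ij mij mtN l jl; first by case: l jl.
have m1N : measurable_fun setT (fun z => (\1_N z : R)%:E).
  exact/measurable_EFinP/measurable_indic.
transitivity (\int[tuple_measure mu m.+1]_t \int[mu]_z (\1_N (z, tnth t l))%:E).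
  apply: eq_integral => t _; apply: eq_integral => z _.
  by rewrite indic_preimage jl tnth_insert_at tnth_insert_at_lift.
have m2N : measurable_fun setT (fun w => \int[mu]_z (\1_N (z, w) : R)%:E).
  apply: measurable_int_r => //.
  apply: (measurableT_comp m1N (g := fun w => (w.2, w.1))).
  exact: measurable_fun_pair.
rewrite (ge0_integral_insert_at mu l); last 2 first.
- by move=> t; exact: integral_ge0.
- by apply: (measurableT_comp m2N); exact: measurable_tnth.
rewrite (eq_integral (cst 0)) ?integral0// => t _.
under eq_integral do rewrite tnth_insert_at.
rewrite -[RHS]N0 (measure_indic_integral _ mN).
apply: etrans _ (esym (tonelli_prod mu mu _ m1N)); last by move=> z.
apply: (tonelli_swap mu mu (F := fun w z => (\1_N (z, w))%:E)).
  by move=> w z.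
by apply: (measurableT_comp m1N (g := fun w => (w.2, w.1))); exact: measurable_fun_pair.
Qed.

End tuple_measure_ae.

Lemma measurable_fst_comp d1 d2 d3 (S : measurableType d1)
    (S1 : measurableType d2) (S2 : measurableType d3) (f : S -> S1 * S2) :
  measurable_fun setT f -> measurable_fun setT (fun x => (f x).1).
Proof. by move=> mf; exact: (measurableT_comp measurable_fst mf). Qed.

Lemma measurable_snd_comp d1 d2 d3 (S : measurableType d1)
    (S1 : measurableType d2) (S2 : measurableType d3) (f : S -> S1 * S2) :
  measurable_fun setT f -> measurable_fun setT (fun x => (f x).2).
Proof. by move=> mf; exact: (measurableT_comp measurable_snd mf). Qed.

(* A separate lemma because [m] does not unify with [?n.-1]. *)
Lemma measurable_drop_atS d d' (S : measurableType d') (T : measurableType d)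
    m (i : 'I_m.+1) (g : S -> m.+1.-tuple T) :
  measurable_fun setT g ->
  measurable_fun setT (fun x => drop_at (g x) i : m.-tuple T).
Proof. exact: measurable_drop_at. Qed.

Lemma measurable_rate d (T : measurableType d) (R : realType)
    (c : T -> T -> T -> T -> R) d' (S : measurableType d') (p q r s : S -> T) :
  measurable_fun [set: T * T * T * T] (fun z => c z.1.1.1 z.1.1.2 z.1.2 z.2) ->
  measurable_fun setT p -> measurable_fun setT q ->
  measurable_fun setT r -> measurable_fun setT s ->
  measurable_fun setT (fun z => (c (p z) (q z) (r z) (s z))%:E).
Proof.
move=> mc mp mq mr ms; apply/measurable_EFinP.
apply: (measurableT_comp mc (g := fun z => (p z, q z, r z, s z))).
by do 3! [apply: measurable_fun_pair => //].
Qed.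

Ltac solve_meas := repeat first
  [ assumption | exact: measurable_id | exact: measurable_cst
  | exact: measurable_fst | exact: measurable_snd
  | apply: measurable_subst_at | apply: measurable_drop_atS | apply: measurable_drop_at
  | apply: measurable_fun_tnth | apply: measurable_rate
  | apply: measurable_fst_comp | apply: measurable_snd_comp].

Section rate_bounds.
Context d (T : measurableType d) (R : realType).
Variable mu : {sigma_finite_measure set T -> \bar R}.
Variable c : T -> T -> T -> T -> R.
Hypothesis c_measurable : measurable_fun [set: T * T * T * T]
  (fun z => c z.1.1.1 z.1.1.2 z.1.2 z.2).
Hypothesis c_ge0 : forall x1 x2 y1 y2, (0 <= c x1 x2 y1 y2)%R.
Hypothesis c_symx : forall x1 x2 y1 y2, c x1 x2 y1 y2 = c x2 x1 y1 y2.
Local Open Scope ereal_scope.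

(** * Jumps of two points: the summands of L_0 *)

Section two_body.
Variables (n : nat) (i j : 'I_n) (ij : i != j).

Definition rate_at (x : n.-tuple T) (y : T * T) : \bar R :=
  (c (tnth x i) (tnth x j) y.1 y.2)%:E.
Definition jump (x : n.-tuple T) (y : T * T) : n.-tuple T :=
  subst_at (subst_at x i y.1) j y.2.

Lemma measurable_rate_at :
  measurable_fun [set: n.-tuple T * (T * T)] (fun z => rate_at z.1 z.2).
Proof. by rewrite /rate_at; solve_meas. Qed.

Lemma measurable_jump :
  measurable_fun [set: n.-tuple T * (T * T)] (fun z => jump z.1 z.2).
Proof. by rewrite /jump; solve_meas. Qed.

(** [ge0_integral_exchange] trades one coordinate for the outer integration variable. So x_i is
    traded for y_1, Tonelli brings y_2 outside, and x_j is traded for y_2. As [i] and [j] differ,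
    neither substitution disturbs the other. *)
Lemma integral_jump (f : n.-tuple T -> \bar R) :
  (forall x, 0 <= f x) -> measurable_fun setT f ->
  \int[tuple_measure mu n]_x \int[mu \x mu]_y (rate_at x y * f (jump x y)) =
  \int[tuple_measure mu n]_x
    (\int[mu \x mu]_y (c y.1 y.2 (tnth x i) (tnth x j))%:E * f x).
Proof.
move=> f0 mf; rewrite /rate_at /jump.
have cf0 a b e h x : 0 <= (c a b e h)%:E * f x by rewrite mule_ge0 ?lee_fin.
have mfc d' (S : measurableType d') (g : S -> n.-tuple T) : measurable_fun setT g ->
    measurable_fun setT (fun z => f (g z)).
  by move=> mg; exact: (measurableT_comp mf mg).
have -> : \int[tuple_measure mu n]_x \int[mu \x mu]_y
      ((c (tnth x i) (tnth x j) y.1 y.2)%:E * f (subst_at (subst_at x i y.1) j y.2)) =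
    \int[tuple_measure mu n]_x \int[mu]_y \int[mu]_z
      ((c (tnth x i) (tnth x j) y z)%:E * f (subst_at (subst_at x i y) j z)).
  apply: eq_integral => x _; apply: (tonelli_prod mu mu).
    by move=> y; exact: cf0.
  by apply: emeasurable_funM; [|apply: mfc]; solve_meas.
rewrite (ge0_integral_exchange mu i); last 2 first.
- by move=> x y; apply: integral_ge0.
- apply: measurable_int_r => //=.
  by apply: emeasurable_funM; [|apply: mfc]; solve_meas.
have -> : \int[tuple_measure mu n]_x \int[mu]_y \int[mu]_z
      ((c (tnth (subst_at x i y) i) (tnth (subst_at x i y) j) (tnth x i) z)%:E *
       f (subst_at (subst_at (subst_at x i y) i (tnth x i)) j z)) =
    \int[tuple_measure mu n]_x \int[mu]_z \int[mu]_y
      ((c y (tnth x j) (tnth x i) z)%:E * f (subst_at x j z)).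
  apply: eq_integral => x _; apply: etrans (tonelli_swap mu mu _ _) _.
  - by move=> y z; exact: cf0.
  - by apply: emeasurable_funM; [|apply: mfc]; solve_meas.
  apply: eq_integral => z _; apply: eq_integral => y _.
  by rewrite subst_at_idem subst_at_tnth !tnth_subst_at eqxx eq_sym (negbTE ij).
rewrite (ge0_integral_exchange mu j); last 2 first.
- by move=> x y; apply: integral_ge0.
- apply: measurable_int_r => //=.
  by apply: emeasurable_funM; [|apply: mfc]; solve_meas.
apply: eq_integral => x _.
apply: etrans (tonelli_swap mu mu _ _) _.
- by move=> y z; exact: cf0.
- by apply: emeasurable_funM; [|apply: mfc]; solve_meas.
rewrite -ge0_integralZr//; last first.
- by move=> y _; rewrite lee_fin.
- by solve_meas.
apply: esym; apply: etrans (tonelli_prod mu mu _ _) _.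
- by move=> y; exact: cf0.
- by apply: emeasurable_funM; [|apply: mfc]; solve_meas.
apply: eq_integral => y _; apply: eq_integral => z _ /=.
by rewrite subst_at_idem subst_at_tnth !tnth_subst_at eqxx (negbTE ij).
Qed.

Lemma le_integral_weight (w : T * T -> \bar R) (M : R) (f : n.-tuple T -> \bar R) :
  (forall z, 0 <= w z) -> measurable_fun setT w ->
  (0 <= M)%R -> (\forall z \ae (mu \x mu), w z <= M%:E) ->
  (forall x, 0 <= f x) -> measurable_fun setT f ->
  \int[tuple_measure mu n]_x (w (tnth x i, tnth x j) * f x) <=
  M%:E * \int[tuple_measure mu n]_x f x.
Proof.
move=> w0 mw M0 wM f0 mf; rewrite -ge0_integralZl//.
apply: ae_ge0_le_integral => //.
- by move=> x _; rewrite mule_ge0.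
- apply: emeasurable_funM => //; apply: (measurableT_comp mw).
  by apply: measurable_fun_pair; exact: measurable_tnth.
- by move=> x _; rewrite mule_ge0.
- exact: measurable_funeM.
- by apply: filterS (ae_tnth2 ij wM) => x wxM _; exact: lee_wpmul2r.
Qed.

End two_body.

(** * Hops with one point deleted: the summands of W *)

Section one_body.
Variables (m : nat) (i j : 'I_m.+1) (l : 'I_m).
Hypothesis jE : j = lift i l.

Definition rate1_at (x : m.+1.-tuple T) (y : T) : \bar R :=
  \int[mu]_w (c (tnth x i) (tnth x j) y w)%:E.
Definition hop (x : m.+1.-tuple T) (y : T) : m.-tuple T :=
  drop_at (subst_at x j y) i.

Let ij : i != j. Proof. by rewrite jE neq_lift. Qed.

Lemma rate1_at_ge0 x y : 0 <= rate1_at x y.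
Proof. by apply: integral_ge0 => w _; rewrite lee_fin. Qed.

Lemma measurable_rate1_at :
  measurable_fun [set: m.+1.-tuple T * T] (fun z => rate1_at z.1 z.2).
Proof.
rewrite /rate1_at; apply: measurable_int_r => [x y|]; first by rewrite lee_fin.
by solve_meas.
Qed.

Lemma measurable_hop :
  measurable_fun [set: m.+1.-tuple T * T] (fun z => hop z.1 z.2).
Proof. by rewrite /hop; solve_meas. Qed.

(** [l] is the position of coordinate [j] after the deletion of coordinate [i]. Trading x_j for [y]
    turns [hop] into plain deletion and the rate into c(x_i, y, x_j, w); integrating out x_i leaves
    the integral of c_4 at t_l. *)
Lemma integral_hop (f : m.-tuple T -> \bar R) :
  (forall x, 0 <= f x) -> measurable_fun setT f ->
  \int[tuple_measure mu m.+1]_x \int[mu]_y (rate1_at x y * f (hop x y)) =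
  \int[tuple_measure mu m]_t
    (\int[mu]_x \int[mu]_y \int[mu]_w (c x y (tnth t l) w)%:E * f t).
Proof.
move=> f0 mf; rewrite /hop.
have mfc d' (S : measurableType d') (g : S -> m.-tuple T) : measurable_fun setT g ->
    measurable_fun setT (fun z => f (g z)).
  by move=> mg; exact: (measurableT_comp mf mg).
rewrite (ge0_integral_exchange mu j); last 2 first.
- by move=> x y; rewrite mule_ge0// rate1_at_ge0.
- apply: emeasurable_funM; first exact: measurable_rate1_at.
  by apply: mfc; solve_meas.
have -> : \int[tuple_measure mu m.+1]_x \int[mu]_y
     (rate1_at (subst_at x j y) (tnth x j) *
      f (drop_at (subst_at (subst_at x j y) j (tnth x j)) i)) =
   \int[tuple_measure mu m.+1]_x \int[mu]_y
     (\int[mu]_w (c (tnth x i) y (tnth x j) w)%:E * f (drop_at x i)).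
  apply: eq_integral => x _; apply: eq_integral => y _.
  rewrite subst_at_idem subst_at_tnth /rate1_at !tnth_subst_at eqxx.
  by rewrite (negbTE ij).
have mk : measurable_fun setT (fun z : m.+1.-tuple T * T =>
    \int[mu]_w (c (tnth z.1 i) z.2 (tnth z.1 j) w)%:E).
  apply: measurable_int_r => [x y|]; first by rewrite lee_fin.
  by solve_meas.
rewrite (ge0_integral_insert_at mu i); last 2 first.
- move=> x; apply: integral_ge0 => y _; rewrite mule_ge0//.
  by apply: integral_ge0 => w _; rewrite lee_fin.
- apply: measurable_int_r => [x y|].
    by rewrite mule_ge0//; apply: integral_ge0 => w _; rewrite lee_fin.
  by apply: emeasurable_funM; [exact: mk|apply: mfc; solve_meas].
apply: eq_integral => t _.
rewrite -ge0_integralZr//; last 2 first.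
- apply: measurable_int_r => [x y|].
    by apply: integral_ge0 => w _; rewrite lee_fin.
  apply: measurable_int_r => [x y|]; first by rewrite lee_fin.
  by solve_meas.
- by move=> x _; do 2 apply: integral_ge0 => ? _; rewrite lee_fin.
apply: eq_integral => x _; rewrite -ge0_integralZr//; last 2 first.
- apply: measurable_int_r => [z y|]; first by rewrite lee_fin.
  by solve_meas.
- by move=> y _; apply: integral_ge0 => ? _; rewrite lee_fin.
apply: eq_integral => y _.
by rewrite drop_at_insert_at tnth_insert_at jE tnth_insert_at_lift.
Qed.

(** [drop_at x i] does not involve x_i, so x_i can be integrated out at once. The weight at t_l is
    the integral of c_3 with the two starting points interchanged. *)
Lemma integral_stay (f : m.-tuple T -> \bar R) :
  (forall x, 0 <= f x) -> measurable_fun setT f ->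
  \int[tuple_measure mu m.+1]_x \int[mu]_y (rate1_at x y * f (drop_at x i)) =
  \int[tuple_measure mu m]_t
    (\int[mu]_x \int[mu]_y \int[mu]_w (c x (tnth t l) y w)%:E * f t).
Proof.
move=> f0 mf.
have mfc d' (S : measurableType d') (g : S -> m.-tuple T) : measurable_fun setT g ->
    measurable_fun setT (fun z => f (g z)).
  by move=> mg; exact: (measurableT_comp mf mg).
rewrite (ge0_integral_insert_at mu i); last 2 first.
- by move=> x; apply: integral_ge0 => y _; rewrite mule_ge0// rate1_at_ge0.
- apply: measurable_int_r => [x y|]; first by rewrite mule_ge0// rate1_at_ge0.
  by apply: emeasurable_funM; [exact: measurable_rate1_at|apply: mfc; solve_meas].
apply: eq_integral => t _.
rewrite -ge0_integralZr//; last 2 first.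
- apply: measurable_int_r => [x y|].
    by apply: integral_ge0 => w _; rewrite lee_fin.
  apply: measurable_int_r => [x y|]; first by rewrite lee_fin.
  by solve_meas.
- by move=> x _; do 2 apply: integral_ge0 => ? _; rewrite lee_fin.
apply: eq_integral => x _; rewrite -ge0_integralZr//; last 2 first.
- apply: measurable_int_r => [z y|]; first by rewrite lee_fin.
  by solve_meas.
- by move=> y _; apply: integral_ge0 => ? _; rewrite lee_fin.
apply: eq_integral => y _.
by rewrite drop_at_insert_at /rate1_at tnth_insert_at jE tnth_insert_at_lift.
Qed.

End one_body.

Lemma le_integral_weight1 m (l : 'I_m) (w : T -> \bar R) (M : R)
    (f : m.-tuple T -> \bar R) :
  (forall z, 0 <= w z) -> measurable_fun setT w ->
  (0 <= M)%R -> (\forall z \ae mu, w z <= M%:E) ->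
  (forall x, 0 <= f x) -> measurable_fun setT f ->
  \int[tuple_measure mu m]_x (w (tnth x l) * f x) <=
  M%:E * \int[tuple_measure mu m]_x f x.
Proof.
move=> w0 mw M0 wM f0 mf; rewrite -ge0_integralZl//.
apply: ae_ge0_le_integral => //.
- by move=> x _; rewrite mule_ge0.
- by apply: emeasurable_funM => //; apply: (measurableT_comp mw);
    exact: measurable_tnth.
- by move=> x _; rewrite mule_ge0.
- exact: measurable_funeM.
- by apply: filterS (ae_tnth l wM) => x wxM _; exact: lee_wpmul2r.
Qed.

Lemma integral_c4 v :
  \int[mu \x mu \x mu]_u (c u.1.1 u.1.2 v u.2)%:E =
  \int[mu]_x \int[mu]_y \int[mu]_w (c x y v w)%:E.
Proof.
apply: etrans (tonelli_prod (sfprod mu mu) mu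
  (F := fun u => (c u.1.1 u.1.2 v u.2)%:E) _ _) _.
- by move=> u; rewrite lee_fin.
- by solve_meas.
apply: (tonelli_prod mu mu (F := fun u => \int[mu]_w (c u.1 u.2 v w)%:E)).
- by move=> u; apply: integral_ge0 => ? _; rewrite lee_fin.
- by apply: measurable_int_r => [x y|]; [rewrite lee_fin|solve_meas].
Qed.

(** In W the first starting point x_i is integrated out and the second survives, whereas [c3] fixes
    the first; the symmetry of the rate in its starting points reconciles the two. For [c4] the
    fixed arrival point is already the right one. *)
Lemma integral_c3 v :
  \int[mu \x mu \x mu]_u (c v u.2 u.1.1 u.1.2)%:E =
  \int[mu]_x \int[mu]_y \int[mu]_w (c x v y w)%:E.
Proof.
apply: etrans (tonelli_prod (sfprod mu mu) mu
  (F := fun u => (c v u.2 u.1.1 u.1.2)%:E) _ _) _.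
- by move=> u; rewrite lee_fin.
- by solve_meas.
apply: etrans (tonelli_swap (sfprod mu mu) mu
  (F := fun u w => (c v w u.1 u.2)%:E) _ _) _.
- by move=> u w; rewrite lee_fin.
- by solve_meas.
apply: eq_integral => x _.
apply: etrans (tonelli_prod mu mu _ _) _.
- by move=> u; rewrite lee_fin.
- by solve_meas.
by apply: eq_integral => y _; apply: eq_integral => w _; rewrite c_symx.
Qed.

End rate_bounds.

(** * Bounds on L0 and W *)

Lemma lebesgue_measure_setT_gt0 (R : realType) :
  (0 < (lebesgue_measure : {measure set (measurableTypeR R) -> \bar R}) setT)%E.
Proof.
have : (lebesgue_measure `[0%R, 1%R]%classic <= lebesgue_measure [set: R])%E.
  by apply: le_measure => //; rewrite inE.
by apply: lt_le_trans; rewrite lebesgue_measure_itv/= lte_fin ltr01 oppr0 adde0 lte01.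
Qed.

Lemma leb_setT_gt0 (R : realType) d : (0 < leb R d setT)%E.
Proof. exact/tuple_measure_gt0/lebesgue_measure_setT_gt0. Qed.

(** Pairs are counted by their larger index [j], which has [j] predecessors. *)
Lemma sum_pairs n : (\sum_(i < n) \sum_(j < n | (i < j)%N) 1 = 'C(n, 2))%N.
Proof.
rewrite -bin2_sum big_mkord (exchange_big_dep predT)//=.
apply: eq_bigr => j _; rewrite -(big_ord_widen n (fun=> 1%N)) ?(ltnW (ltn_ord j))//.
by rewrite sum_nat_const card_ord muln1.
Qed.

Lemma sum_pairs_cst (R : realType) n (M : R) :
  \sum_(i < n) \sum_(j < n | (i < j)%N) M = n%:R * (n%:R - 1) / 2 * M.
Proof.
transitivity (M * (\sum_(i < n) \sum_(j < n | (i < j)%N) 1)%N%:R).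
  rewrite natr_sum mulr_sumr; apply: eq_bigr => i _.
  by rewrite natr_sum mulr_sumr; apply: eq_bigr => j _; rewrite mulr1.
have E : n%:R * (n%:R - 1) = 'C(n, 2)%:R * 2 :> R.
  have : ('C(n, 2) * 2 = n * n.-1)%N.
    by rewrite bin2 muln2 halfK; case: n => // n; rewrite /= oddM /= andNb subn0.
  (* At n = 0 the real number n - 1 is -1 while [n.-1] is 0; the factor n makes both products
     vanish. *)
  case: n => [|n]; first by rewrite !mul0r.
  by move=> /(congr1 (fun k => k%:R : R)); rewrite !natrM => ->;
    rewrite -[X in _ * (X - 1)]natr1 addrK.
by rewrite sum_pairs E mulfK// mulrC.
Qed.

Section operators.
Context (R : realType) (d : nat) (c : Rd R d -> Rd R d -> Rd R d -> Rd R d -> R).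
Hypothesis c_measurable :
  measurable_fun [set: Rd R d * Rd R d * Rd R d * Rd R d]
       (fun z => c z.1.1.1 z.1.1.2 z.1.2 z.2).
Hypothesis c_ge0 : forall x1 x2 y1 y2, 0 <= c x1 x2 y1 y2.
Hypothesis c_symx : forall x1 x2 y1 y2, c x1 x2 y1 y2 = c x2 x1 y1 y2.
Local Notation E := (Rd R d).
Local Notation mu := (leb R d).
Local Open Scope ereal_scope.

Let cfin0 x1 x2 y1 y2 : 0 <= (c x1 x2 y1 y2)%:E.
Proof. by rewrite lee_fin. Qed.

(** Positive total mass keeps the essential supremum of a nonnegative function from being -oo, its
    value for the zero measure; being below +oo, it is then a real number. *)
Lemma ess_sup_fin d' (S : measurableType d') (nu : {measure set S -> \bar R})
    (f : S -> \bar R) : 0 < nu setT -> (forall x, 0 <= f x) ->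
  ess_sup nu f < +oo ->
  exists M : R, [/\ (0 <= M)%R, ess_sup nu f = M%:E & \forall x \ae nu, f x <= M%:E].
Proof.
move=> nu0 f0 fy; have f_ge0 : 0 <= ess_sup nu f by apply: ess_sup_gee => //; exact/nearW.
exists (fine (ess_sup nu f)); rewrite fine_ge0// fineK ?ge0_fin_numE//.
by split => //; exact: ess_sup_ge.
Qed.

Section L0.
Hypotheses (c1y : c1 c < +oo) (c2y : c2 c < +oo).

Lemma c1P : exists M : R, [/\ (0 <= M)%R, c1 c = M%:E &
  \forall x \ae (mu \x mu), a1 c x.1 x.2 <= M%:E].
Proof.
apply: ess_sup_fin => //; first exact/prod_measure_gt0/leb_setT_gt0.
by move=> x; apply: integral_ge0.
Qed.

Lemma c2P : exists M : R, [/\ (0 <= M)%R, c2 c = M%:E &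
  \forall x \ae (mu \x mu), a2 c x.1 x.2 <= M%:E].
Proof.
apply: ess_sup_fin => //; first exact/prod_measure_gt0/leb_setT_gt0.
by move=> x; apply: integral_ge0.
Qed.

Lemma measurable_a1 : measurable_fun setT (fun x : E * E => a1 c x.1 x.2).
Proof.
apply: (@measurable_int_r _ _ _ _ _ (sfprod mu mu)
  (fun x y => (c x.1 x.2 y.1 y.2)%:E)) => //.
by solve_meas.
Qed.

Lemma measurable_a2 : measurable_fun setT (fun x : E * E => a2 c x.1 x.2).
Proof.
apply: (@measurable_int_r _ _ _ _ _ (sfprod mu mu)
  (fun x y => (c y.1 y.2 x.1 x.2)%:E)) => //.
by solve_meas.
Qed.

Lemma integral_jump_a2 n (i j : 'I_n) (f : n.-tuple E -> \bar R) : i != j ->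
  (forall x, 0 <= f x) -> measurable_fun setT f ->
  \int[conf_leb R d n]_x \int[mu \x mu]_y (rate_at c i j x y * f (jump i j x y)) =
  \int[conf_leb R d n]_x (a2 c (tnth x i) (tnth x j) * f x).
Proof.
move=> ij f0 mf; rewrite integral_jump//; exact: eq_integral.
Qed.

Lemma integral_rate_a1 n (i j : 'I_n) (f : \bar R) x : 0 <= f ->
  \int[mu \x mu]_y (rate_at c i j x y * f) = a1 c (tnth x i) (tnth x j) * f.
Proof.
move=> f0; rewrite ge0_integralZr//; last by move=> y _; exact: cfin0.
by rewrite /rate_at; solve_meas.
Qed.

Definition pair_op n (i j : 'I_n) : (n.-tuple E -> R) -> n.-tuple E -> R :=
  kernel_op (sfprod mu mu) (rate_at c i j) (jump i j) id.

Lemma L0_funE n f x :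
  L0_fun c (n:=n) f x = (\sum_(i < n) \sum_(j < n | (i < j)%N) pair_op i j f x)%R.
Proof. by []. Qed.

Lemma jump_le n (i j : 'I_n) (M : R) : i != j -> (0 <= M)%R ->
  (\forall x \ae (mu \x mu), a2 c x.1 x.2 <= M%:E) ->
  forall f : n.-tuple E -> \bar R, (forall x, 0 <= f x) -> measurable_fun setT f ->
  \int[conf_leb R d n]_x \int[sfprod mu mu]_y (rate_at c i j x y * f (jump i j x y))
   <= M%:E * \int[conf_leb R d n]_x f x.
Proof.
move=> ij M0 a2M f f0 mf; rewrite [leLHS]integral_jump_a2//.
apply: (le_integral_weight ij (w := fun x => a2 c x.1 x.2)) => //.
- by move=> z; apply: integral_ge0.
- exact: measurable_a2.
Qed.

Lemma stay_le n (i j : 'I_n) (M : R) : i != j -> (0 <= M)%R ->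
  (\forall x \ae (mu \x mu), a1 c x.1 x.2 <= M%:E) ->
  forall f : n.-tuple E -> \bar R, (forall x, 0 <= f x) -> measurable_fun setT f ->
  \int[conf_leb R d n]_x \int[sfprod mu mu]_y (rate_at c i j x y * f x)
   <= M%:E * \int[conf_leb R d n]_x f x.
Proof.
move=> ij M0 a1M f f0 mf.
rewrite (eq_integral (fun x => a1 c (tnth x i) (tnth x j) * f x)); last first.
  by move=> x _; exact: integral_rate_a1.
apply: (le_integral_weight ij (w := fun x => a1 c x.1 x.2)) => //.
- by move=> z; apply: integral_ge0.
- exact: measurable_a1.
Qed.

Lemma pair_op_L1bounded n (i j : 'I_n) (M1 M2 : R) : i != j ->
  (0 <= M1)%R -> (\forall x \ae (mu \x mu), a1 c x.1 x.2 <= M1%:E) ->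
  (0 <= M2)%R -> (\forall x \ae (mu \x mu), a2 c x.1 x.2 <= M2%:E) ->
  L1bounded (conf_leb R d n) (conf_leb R d n) (pair_op i j) (M2 + M1).
Proof.
move=> ij M10 a1M M20 a2M; apply: kernel_op_L1bounded => //.
- by move=> x y; exact: cfin0.
- exact: measurable_rate_at.
- exact: measurable_jump.
- exact: jump_le.
- exact: stay_le.
Qed.

(** Arbitrary a.e. bounds replace [c1] and [c2], because under a_2 <= a_1 the contraction argument
    uses one bound for both rates. *)
Lemma L0_L1bounded n (M1 M2 : R) :
  (0 <= M1)%R -> (\forall x \ae (mu \x mu), a1 c x.1 x.2 <= M1%:E) ->
  (0 <= M2)%R -> (\forall x \ae (mu \x mu), a2 c x.1 x.2 <= M2%:E) ->
  L1bounded (conf_leb R d n) (conf_leb R d n) (L0_fun c (n:=n))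
    (n%:R * (n%:R - 1) / 2 * (M1 + M2))%R.
Proof.
move=> M10 a1M M20 a2M.
have H : L1bounded (conf_leb R d n) (conf_leb R d n)
    (fun f x => \sum_(i < n) \sum_(j < n | (i < j)%N) pair_op i j f x)%R
    (\sum_(i < n) \sum_(j < n | (i < j)%N) (M2 + M1))%R.
  apply: L1bounded_sum => i _; apply: L1bounded_sum => j ij.
  by apply: pair_op_L1bounded => //; rewrite neq_ltn ij.
by apply: eq_L1bounded H => //; rewrite sum_pairs_cst [(M1 + M2)%R]addrC.
Qed.

Lemma L0_well n : L0_well_defined c n.
Proof.
have [M1 [M10 _ a1M]] := c1P; have [M2 [M20 _ a2M]] := c2P.
split; first by have [] := L0_L1bounded n M10 a1M M20 a2M.
move=> G LG; have H (i j : 'I_n) : (i < j)%N -> \forall x \ae conf_leb R d n,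
    (mu \x mu).-integrable setT (EFin \o L0_integrand c G x i j).
  move=> ij; have {}ij : i != j by rewrite neq_ltn ij.
  apply: (@kernel_integrable _ _ _ _ _ _ _ (conf_leb R d n) (conf_leb R d n)
    (sfprod mu mu) (rate_at c i j) (jump i j) id M2 M1) => //.
  - by move=> x y; exact: cfin0.
  - exact: measurable_rate_at.
  - exact: measurable_jump.
  - exact: jump_le.
  - exact: stay_le.
(* The exceptional null set depends on the pair; there are finitely many pairs. *)
have {}H : \forall x \ae conf_leb R d n, forall i j : 'I_n, (i < j)%N ->
    (mu \x mu).-integrable setT (EFin \o L0_integrand c G x i j).
  apply: filter_forall => i; apply: filter_forall => j.
  by have [ij|nij] := boolP (i < j)%N; [apply: filterS (H _ _ ij)|exact/nearW].
by apply: filterS H => x Hx i j ij; exact: Hx.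
Qed.

Lemma L0_norm_le n (G : X R d n) :
  (`|L0 c G|)%:E <= (n%:R * (n%:R - 1) / 2)%:E * (c1 c + c2 c) * (`|G|)%:E.
Proof.
have [M1 [M10 -> a1M]] := c1P; have [M2 [M20 -> a2M]] := c2P.
rewrite -EFinD -!EFinM lee_fin.
exact: (L1bounded_norm G (L0_L1bounded n M10 a1M M20 a2M)).
Qed.

End L0.

Section W.
Hypotheses (c3y : c3 c < +oo) (c4y : c4 c < +oo).

Lemma c3P : exists M : R, [/\ (0 <= M)%R, c3 c = M%:E &
  \forall v \ae mu, \int[mu]_x \int[mu]_y \int[mu]_w (c x v y w)%:E <= M%:E].
Proof.
have E : c3 c = ess_sup mu (fun v => \int[mu]_x \int[mu]_y \int[mu]_w (c x v y w)%:E).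
  by congr ess_sup; apply/funext => v; exact: integral_c3.
rewrite E; apply: ess_sup_fin; last by rewrite -E.
  exact/leb_setT_gt0.
by move=> v; do 3 apply: integral_ge0 => ? _; exact: cfin0.
Qed.

Lemma c4P : exists M : R, [/\ (0 <= M)%R, c4 c = M%:E &
  \forall v \ae mu, \int[mu]_x \int[mu]_y \int[mu]_w (c x y v w)%:E <= M%:E].
Proof.
have E : c4 c = ess_sup mu (fun v => \int[mu]_x \int[mu]_y \int[mu]_w (c x y v w)%:E).
  by congr ess_sup; apply/funext => v; exact: integral_c4.
rewrite E; apply: ess_sup_fin; last by rewrite -E.
  exact/leb_setT_gt0.
by move=> v; do 3 apply: integral_ge0 => ? _; exact: cfin0.
Qed.

Lemma hop_le m (i j : 'I_m.+1) (M : R) : j != i -> (0 <= M)%R ->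
  (\forall v \ae mu, \int[mu]_x \int[mu]_y \int[mu]_w (c x y v w)%:E <= M%:E) ->
  forall f : m.-tuple E -> \bar R, (forall x, 0 <= f x) -> measurable_fun setT f ->
  \int[conf_leb R d m.+1]_x \int[mu]_y (rate1_at mu c i j x y * f (hop i j x y))
   <= M%:E * \int[conf_leb R d m]_x f x.
Proof.
rewrite eq_sym; have [l jE _|-> ] := unliftP i j; last by rewrite eqxx.
move=> M0 cM f f0 mf; rewrite [leLHS](integral_hop _ c_measurable c_ge0 jE)//.
apply: (le_integral_weight1 l
  (w := fun v => \int[mu]_x \int[mu]_y \int[mu]_w (c x y v w)%:E)) => //.
  by move=> v; do 3 apply: integral_ge0 => ? _.
apply: measurable_int_r => [v x|]; first by do 2 apply: integral_ge0 => ? _.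
apply: measurable_int_r => [v x|]; first by apply: integral_ge0 => ? _.
apply: measurable_int_r => [v x|]; first exact: cfin0.
by solve_meas.
Qed.

Lemma stay1_le m (i j : 'I_m.+1) (M : R) : j != i -> (0 <= M)%R ->
  (\forall v \ae mu, \int[mu]_x \int[mu]_y \int[mu]_w (c x v y w)%:E <= M%:E) ->
  forall f : m.-tuple E -> \bar R, (forall x, 0 <= f x) -> measurable_fun setT f ->
  \int[conf_leb R d m.+1]_x \int[mu]_y (rate1_at mu c i j x y * f (drop_at x i))
   <= M%:E * \int[conf_leb R d m]_x f x.
Proof.
rewrite eq_sym; have [l jE _|-> ] := unliftP i j; last by rewrite eqxx.
move=> M0 cM f f0 mf; rewrite [leLHS](integral_stay _ c_measurable c_ge0 jE)//.
apply: (le_integral_weight1 l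
  (w := fun v => \int[mu]_x \int[mu]_y \int[mu]_w (c x v y w)%:E)) => //.
  by move=> v; do 3 apply: integral_ge0 => ? _.
apply: measurable_int_r => [v x|]; first by do 2 apply: integral_ge0 => ? _.
apply: measurable_int_r => [v x|]; first by apply: integral_ge0 => ? _.
apply: measurable_int_r => [v x|]; first exact: cfin0.
by solve_meas.
Qed.

Definition hop_op m (i j : 'I_m.+1) : (m.-tuple E -> R) -> m.+1.-tuple E -> R :=
  kernel_op mu (rate1_at mu c i j) (hop i j) (fun x => drop_at x i).

Lemma hop_op_L1bounded m (i j : 'I_m.+1) (M3 M4 : R) : j != i ->
  (0 <= M3)%R ->
  (\forall v \ae mu, \int[mu]_x \int[mu]_y \int[mu]_w (c x v y w)%:E <= M3%:E) ->
  (0 <= M4)%R ->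
  (\forall v \ae mu, \int[mu]_x \int[mu]_y \int[mu]_w (c x y v w)%:E <= M4%:E) ->
  L1bounded (conf_leb R d m) (conf_leb R d m.+1) (hop_op i j) (M4 + M3).
Proof.
move=> ij M30 c3M M40 c4M; apply: kernel_op_L1bounded => //.
- by move=> x y; exact: rate1_at_ge0.
- exact: measurable_rate1_at.
- exact: measurable_hop.
- exact: measurable_drop_atS.
- exact: hop_le.
- exact: stay1_le.
Qed.

Lemma W_L1bounded m (M3 M4 : R) :
  (0 <= M3)%R ->
  (\forall v \ae mu, \int[mu]_x \int[mu]_y \int[mu]_w (c x v y w)%:E <= M3%:E) ->
  (0 <= M4)%R ->
  (\forall v \ae mu, \int[mu]_x \int[mu]_y \int[mu]_w (c x y v w)%:E <= M4%:E) ->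
  L1bounded (conf_leb R d m) (conf_leb R d m.+1) (W_fun c (n:=m.+1))
    (m.+1%:R * (m.+1%:R - 1) * (M3 + M4))%R.
Proof.
move=> M30 c3M M40 c4M.
have H : L1bounded (conf_leb R d m) (conf_leb R d m.+1)
    (fun f x => \sum_(i < m.+1) \sum_(j < m.+1 | j != i) hop_op i j f x)%R
    (\sum_(i < m.+1) \sum_(j < m.+1 | j != i) (M4 + M3))%R.
  apply: L1bounded_sum => i _; apply: L1bounded_sum => j ij.
  exact: hop_op_L1bounded.
apply: eq_L1bounded H => //; rewrite [(M3 + M4)%R]addrC.
(* Each of the m + 1 indices [i] leaves m choices of [j], hence n(n-1) ordered pairs with n = m +
   1. *)
under eq_bigr => i _.
  rewrite sumr_const (_ : #|_| = m); last by rewrite cardC1 card_ord.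
  over.
rewrite sumr_const card_ord -mulrnA -[LHS]mulr_natl.
by rewrite -[X in (_ * (X - 1) * _)%R]natr1 addrK -natrM mulnC.
Qed.

Lemma W_well n : (0 < n)%N -> W_well_defined c n.
Proof.
case: n => // m _.
have [M3 [M30 _ c3M]] := c3P; have [M4 [M40 _ c4M]] := c4P.
split; first by have [] := W_L1bounded m M30 c3M M40 c4M.
move=> G LG; have H (i j : 'I_m.+1) : j != i -> \forall x \ae conf_leb R d m.+1,
    mu.-integrable setT (W_integrand c G x i j).
  move=> ij.
  apply: (@kernel_integrable _ _ _ _ _ _ _ (conf_leb R d m) (conf_leb R d m.+1)
    mu (rate1_at mu c i j) (hop i j) (fun x => drop_at x i) M4 M3) => //.
  - by move=> x y; exact: rate1_at_ge0.
  - exact: measurable_rate1_at.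
  - exact: measurable_hop.
  - exact: measurable_drop_atS.
  - exact: hop_le.
  - exact: stay1_le.
have {}H : \forall x \ae conf_leb R d m.+1, forall i j : 'I_m.+1, j != i ->
    mu.-integrable setT (W_integrand c G x i j).
  apply: filter_forall => i; apply: filter_forall => j.
  by have [ij|nij] := boolP (j != i); [apply: filterS (H _ _ ij)|exact/nearW].
by apply: filterS H => x Hx i j ij; exact: Hx.
Qed.

Lemma W_norm_le n (G : X R d n.-1) : (0 < n)%N ->
  (`|W c G|)%:E <= (n%:R * (n%:R - 1))%:E * (c3 c + c4 c) * (`|G|)%:E.
Proof.
case: n G => // m G _.
have [M3 [M30 -> c3M]] := c3P; have [M4 [M40 -> c4M]] := c4P.
rewrite -EFinD -!EFinM lee_fin.
exact: (L1bounded_norm G (W_L1bounded m M30 c3M M40 c4M)).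
Qed.

End W.
End operators.

(** * Completeness of L^1 *)

Section L1_complete.
Context d (T : measurableType d) (R : realType).
Variable mu : {measure set T -> \bar R}.

Lemma nneseries_lty_cvg (a : nat -> R) : (forall k, 0 <= a k) ->
  (\sum_(k <oo) (a k)%:E < +oo)%E <-> cvgn (series a).
Proof.
move=> a0; have pE N : (\sum_(0 <= k < N) (a k)%:E)%E = (series a N)%:E.
  by rewrite sumEFin.
split=> [ay|ca]; last first.
  rewrite (_ : (fun N => _) = fun N => (series a N)%:E); last exact/funext.
  by rewrite EFin_lim// ltry.
have s0 : (0 <= \sum_(k <oo) (a k)%:E)%E.
  by apply: nneseries_ge0 => k _ _; rewrite lee_fin.
apply: nondecreasing_is_cvgn.
  by apply/nondecreasing_seqP => N; rewrite seriesS lerDr.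
exists (fine (\sum_(k <oo) (a k)%:E)%E) => _ [N _ <-].
rewrite -lee_fin -pE fineK ?ge0_fin_numE//.
by apply: nneseries_lim_ge => k _ _; rewrite lee_fin.
Qed.

Lemma L1class_sum (f : nat -> L1fun mu) N :
  L1class (\sum_(0 <= k < N) f k) = \sum_(0 <= k < N) L1class (f k).
Proof.
elim: N => [|N IH]; first by rewrite !big_nil.
by rewrite !big_nat_recr//= L1classD IH.
Qed.

Lemma L1fun_sumE (f : nat -> L1fun mu) N x :
  (\sum_(0 <= k < N) f k) x = \sum_(0 <= k < N) f k x.
Proof.
elim: N => [|N IH]; first by rewrite !big_nil.
by rewrite !big_nat_recr//= -IH.
Qed.

Lemma L1classB (f g : L1fun mu) : L1class (f - g) = L1class f - L1class g.
Proof.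
by apply: (addIr (L1class g)); rewrite -L1classD !subrK.
Qed.

(** The sum [G] of all |f_k| has finite integral by monotone convergence. It is therefore finite
    a.e., where the series converges absolutely, and it dominates all partial sums. *)
Lemma L1space_complete (u : nat -> L1space mu) :
  cvgn (series (fun k => `|u k|)) -> cvgn (series u).
Proof.
move=> ucv.
pose f k : L1fun mu := L1repr (u k).
have mf k : measurable_fun setT (f k : T -> R) by exact: measurable_funPT.
have uE k : u k = L1class (f k) by rewrite L1reprK.
have int_f k : (\int[mu]_x `|f k x|%:E = `|u k|%:E)%E by rewrite uE L1normP Lnorm1.
pose G x := (\sum_(k <oo) `|f k x|%:E)%E.
have G0 x : (0 <= G x)%E by apply: nneseries_ge0 => k _ _; rewrite lee_fin.
have mabs k : measurable_fun setT (fun x => `|f k x|%:E).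
  by apply/measurable_EFinP/measurableT_comp.
have mG : measurable_fun setT G.
  by apply: ge0_emeasurable_sum => // k x _ _; rewrite lee_fin.
have Gy : (\int[mu]_x G x < +oo)%E.
  rewrite integral_nneseries//; under eq_eseriesr do rewrite int_f.
  exact/nneseries_lty_cvg.
have Gae : \forall x \ae mu, (G x < +oo)%E by exact: ge0_integral_lty_ae.
have iG : mu.-integrable setT G.
  by apply/integrableP; split=> //; rewrite (eq_integral G)// => x _; rewrite gee0_abs.
pose S N x := \sum_(0 <= k < N) f k x.
(* The upper limit is measurable even where the series diverges, and agrees with the sum wherever
   [G] is finite. *)
pose F x := fine (limn_esup (fun N => (S N x)%:E)).
have mS N : measurable_fun setT (S N) by apply: measurable_sum.
have mF : measurable_fun setT F.
  apply: (measurableT_comp (f := @fine R)) => //.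
  apply: measurable_fun_limn_esup => N; exact/measurable_EFinP.
have SF x : (G x < +oo)%E -> S N x @[N --> \oo] --> F x.
  move=> /nneseries_lty_cvg -/(_ (fun k => normr_ge0 _)) /(@normed_cvg _ R^o) c.
  have SE : (fun N => S N x) = series (fun k => f k x) by [].
  have cE : (S N x)%:E @[N --> \oo] --> (limn (series (fun k => f k x)))%:E.
    by apply: cvg_EFin; [exact: nearW|exact: c].
  by rewrite /F (cvg_limn_einf_sup cE).2.
have SG x N : (`|(S N x)%:E| <= G x)%E.
  rewrite abse_EFin (@le_trans _ _ (\sum_(0 <= k < N) `|f k x|%:E)%E)//.
    by rewrite sumEFin lee_fin ler_norm_sum.
  by apply: nneseries_lim_ge => k _ _; rewrite lee_fin.
have [||||| iF dF _] := @dominated_convergence _ _ _ mu _ measurableT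
  (fun N x => (S N x)%:E) (EFin \o F) G.
- by move=> N; exact/measurable_EFinP.
- exact/measurable_EFinP.
- by apply: filterS Gae => x Gx _; apply: cvg_EFin; [exact: nearW|exact: SF].
- exact: iG.
- by apply/nearW => x N _; exact: SG.
have LF : F \in Lfun mu 1 by apply/Lfun1_integrable.
pose v : L1space mu := L1class (Lfun_Sub _ LF).
apply/cvg_ex; exists v; apply/subr_cvg0/norm_cvg0P.
have nE N : `|series u N - v|%:E = (\int[mu]_x `|(S N x)%:E - (F x)%:E|)%E.
  have -> : series u N = L1class (\sum_(0 <= k < N) f k).
    by rewrite L1class_sum; apply: eq_bigr.
  rewrite -L1classB L1normP Lnorm1; apply: eq_integral => x _.
  by rewrite /S -(L1fun_sumE f N x).
have : ((fun N => `|series u N - v|%:E) @ \oo --> 0%:E)%E.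
  by under eq_fun do rewrite nE.
by move=> /fine_cvgP[].
Qed.

End L1_complete.

(** * Semigroup generated by a bounded dissipative operator *)

Section contraction_exponential.
Context (R : realType) (V : normedModType R) (B : {linear V -> V}).
Hypothesis B_contr : forall u, `|B u| <= `|u|.

(** This is p(B) u. With polynomials as the carrier, composition of partial sums becomes
    multiplication in a commutative ring, and estimates reduce to signs of coefficients and values
    at 1. *)
Definition poly_act (p : {poly R}) (u : V) : V :=
  \sum_(i < size p) p`_i *: iter i B u.

(** The number of terms in [poly_act] varies with [size p]; a common larger number of terms lets
    several polynomials be compared termwise. *)
Lemma poly_actE N (p : {poly R}) u : (size p <= N)%N ->
  poly_act p u = \sum_(i < N) p`_i *: iter i B u.
Proof.
move=> pN; rewrite /poly_act (big_ord_widen N (fun i => p`_i *: iter i B u))//.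
rewrite big_mkcond; apply: eq_bigr => i _.
by case: ltnP => // /(nth_default 0) ->; rewrite scale0r.
Qed.

Lemma poly_actD (p q : {poly R}) u : poly_act (p + q) u = poly_act p u + poly_act q u.
Proof.
pose N := maxn (size p) (size q).
rewrite (@poly_actE N (p + q)) ?size_polyD// (@poly_actE N p) ?leq_maxl//.
rewrite (@poly_actE N q) ?leq_maxr// -big_split/=.
by apply: eq_bigr => i _; rewrite coefD scalerDl.
Qed.

Lemma poly_actZ a (p : {poly R}) u : poly_act (a *: p) u = a *: poly_act p u.
Proof.
rewrite (@poly_actE (size p) (a *: p)) ?size_scale_leq// scaler_sumr.
by apply: eq_bigr => i _; rewrite coefZ scalerA.
Qed.

Lemma poly_actB (p q : {poly R}) u : poly_act (p - q) u = poly_act p u - poly_act q u.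
Proof. by rewrite poly_actD -scaleN1r poly_actZ scaleN1r. Qed.

Lemma iter_linear i : linear (iter i B).
Proof.
elim: i => [//|i IH] a u v.
by rewrite !iterS IH linearP.
Qed.

Lemma poly_act_linear p : linear (poly_act p).
Proof.
move=> a u v; rewrite /poly_act scaler_sumr -big_split; apply: eq_bigr => i _ /=.
by rewrite iter_linear scalerDr !scalerA mulrC.
Qed.

Lemma poly_actBr p u v : poly_act p (u - v) = poly_act p u - poly_act p v.
Proof. by rewrite addrC -scaleN1r poly_act_linear scaleN1r addrC. Qed.

Lemma poly_actC a u : poly_act a%:P u = a *: u.
Proof. by rewrite (@poly_actE 1) ?size_polyC_leq1// big_ord1 coefC. Qed.

Lemma poly_act0 u : poly_act 0 u = 0.
Proof. by rewrite /poly_act size_poly0 big_ord0. Qed.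

Lemma poly_actX u : poly_act 'X u = B u.
Proof.
by rewrite /poly_act size_polyX big_ord_recl big_ord1 !coefX scale0r add0r scale1r.
Qed.

Lemma poly_actMX (p : {poly R}) u : poly_act (p * 'X) u = B (poly_act p u).
Proof.
rewrite (@poly_actE (size p).+1); last first.
  by rewrite (leq_trans (size_polyMleq _ _))// size_polyX addn2.
rewrite big_ord_recl coefMX eqxx scale0r add0r linear_sum.
by apply: eq_bigr => i _; rewrite coefMX linearZ.
Qed.

Lemma poly_actM (p q : {poly R}) u : poly_act (p * q) u = poly_act p (poly_act q u).
Proof.
elim/poly_ind: p => [|p a IH].
  by rewrite mul0r !poly_act0.
rewrite mulrDl mulrAC poly_actD poly_actMX IH poly_actD poly_actMX.
by rewrite mul_polyC poly_actZ poly_actC.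
Qed.

Lemma norm_iter_le i u : `|iter i B u| <= `|u|.
Proof. by elim: i => // i IH; rewrite iterS (le_trans (B_contr _)). Qed.

Lemma norm_poly_act_le (p : {poly R}) u :
  (forall i, 0 <= p`_i) -> `|poly_act p u| <= p.[1] * `|u|.
Proof.
move=> p0; rewrite (le_trans (ler_norm_sum _ _ _))// horner_coef mulr_suml.
apply: ler_sum => i _; rewrite expr1n mulr1 normrZ ger0_norm//.
by rewrite ler_wpM2l// norm_iter_le.
Qed.

Definition exp_poly (N : nat) (s : R) : {poly R} := \poly_(k < N) exp_coeff s k.

Lemma coef_exp_poly N s k : (exp_poly N s)`_k = if (k < N)%N then exp_coeff s k else 0.
Proof. by rewrite coef_poly. Qed.

Lemma exp_poly1 N s : (exp_poly N s).[1] = series (exp_coeff s) N.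
Proof.
rewrite /series/= big_mkord (@horner_coef_wide _ N) ?size_poly//.
by apply: eq_bigr => i _; rewrite coef_poly ltn_ord expr1n mulr1.
Qed.

Lemma cvg_exp_poly1 s : (exp_poly N s).[1] @[N --> \oo] --> expR s.
Proof.
under eq_fun do rewrite exp_poly1.
exact: is_cvg_series_exp_coeff.
Qed.

Lemma poly_act_exp N s u :
  poly_act (exp_poly N s) u = series (fun k => exp_coeff s k *: iter k B u) N.
Proof.
rewrite (@poly_actE N) ?size_poly// /series/= big_mkord.
by apply: eq_bigr => i _; rewrite coef_poly ltn_ord.
Qed.

Hypothesis V_complete : forall u : nat -> V,
  cvgn (series (fun k => `|u k|)) -> cvgn (series u).

Lemma is_cvg_exp_act s u : cvgn (fun N => poly_act (exp_poly N s) u).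
Proof.
under eq_fun do rewrite poly_act_exp.
apply: V_complete; apply: (@series_le_cvg _ _ (fun k => `|u| * exp_coeff `|s| k)).
- by move=> k.
- by move=> k; rewrite mulr_ge0// exp_coeff_ge0.
- move=> k; rewrite normrZ mulrC ler_pM ?norm_iter_le//.
  by rewrite /exp_coeff/= normrM normrX normfV normr_nat.
- by apply: is_cvg_seriesZ; exact: is_cvg_series_exp_coeff.
Qed.

Definition exp_act (s : R) (u : V) : V :=
  limn (fun N => poly_act (exp_poly N s) u).

Lemma cvg_exp_act s u : poly_act (exp_poly N s) u @[N --> \oo] --> exp_act s u.
Proof. exact: is_cvg_exp_act. Qed.

Lemma exp_act_linear s : linear (exp_act s).
Proof.
move=> a u v; apply: cvg_lim => //.
under eq_fun do rewrite poly_act_linear.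
by apply: cvgD; [apply: cvgZr|]; exact: cvg_exp_act.
Qed.

Lemma exp_actZ s a u : exp_act s (a *: u) = a *: exp_act s u.
Proof.
have e0 : exp_act s 0 = 0.
  by have := exp_act_linear s (-1) 0 0; rewrite scaler0 addr0 scaleN1r addNr.
by have := exp_act_linear s a u 0; rewrite e0 !addr0.
Qed.

(** The limit of [norm_poly_act_le] along the partial sums minus [p]. It is applied with [p] equal
    to 0 for the norm bound, to 1 at time 0, and to 1 + s X for the generator. *)
Lemma norm_exp_act_sub_le (p : {poly R}) s u :
  (\forall N \near \oo, forall i, 0 <= (exp_poly N s - p)`_i) ->
  `|exp_act s u - poly_act p u| <= (expR s - p.[1]) * `|u|.
Proof.
move=> p0.
have cv : poly_act (exp_poly N s - p) u @[N --> \oo] --> exp_act s u - poly_act p u.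
  have -> : (fun N => poly_act (exp_poly N s - p) u) =
      (fun N => poly_act (exp_poly N s) u - poly_act p u).
    by apply/funext => N; rewrite poly_actB.
  by apply: cvgB; [exact: cvg_exp_act|exact: cvg_cst].
have cr : ((exp_poly N s).[1] - p.[1]) * `|u| @[N --> \oo] --> (expR s - p.[1]) * `|u|.
  by apply: cvgMr_tmp; apply: cvgB; [exact: cvg_exp_poly1|exact: cvg_cst].
apply: (ler_cvg_to (cvg_norm cv) cr).
by apply: filterS p0 => N p0; rewrite -hornerN -hornerD norm_poly_act_le.
Qed.

Lemma exp_poly_ge0 N s i : 0 <= s -> 0 <= (exp_poly N s)`_i.
Proof. by move=> s0; rewrite coef_exp_poly; case: ifP => // _; exact: exp_coeff_ge0. Qed.

Lemma norm_exp_act_le s u : 0 <= s -> `|exp_act s u| <= expR s * `|u|.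
Proof.
move=> s0; have := @norm_exp_act_sub_le 0 s u.
rewrite poly_act0 horner0 !subr0; apply.
by apply: nearW => N i; rewrite subr0 exp_poly_ge0.
Qed.

(** Below degree [N] the coefficients of both polynomials agree by the binomial formula; from degree
    [N] on, only the product has terms, and these are nonnegative. *)
Lemma exp_polyM_ge0 N s t i : 0 <= s -> 0 <= t ->
  0 <= (exp_poly N s * exp_poly N t - exp_poly N (s + t))`_i.
Proof.
move=> s0 t0; rewrite coefB subr_ge0 coef_exp_poly; case: ifP => [iN|_]; last first.
  by rewrite coefM; apply: sumr_ge0 => j _; rewrite mulr_ge0// exp_poly_ge0.
rewrite coefM /exp_coeff/= addrC exprDn mulr_suml; apply: ler_sum => j _.
have jN : (j < N)%N by rewrite (leq_ltn_trans _ iN)// -ltnS.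
have ijN : (i - j < N)%N by rewrite (leq_ltn_trans (leq_subr _ _) iN).
rewrite !coef_exp_poly jN ijN /exp_coeff/=.
have ji : (j <= i)%N by rewrite -ltnS.
rewrite -(bin_fact ji) -mulr_natr !natrM.
rewrite le_eqVlt; apply/orP; left; apply/eqP.
field.
by rewrite !pnatr_eq0 -!lt0n !fact_gt0 bin_gt0 ji.
Qed.

(** Both sides are limits of one sequence: the partial sum at [s] applied to the partial sum at
    [t]. *)
Lemma exp_actD s t u : 0 <= s -> 0 <= t ->
  exp_act (s + t) u = exp_act s (exp_act t u).
Proof.
move=> s0 t0.
(* The difference from the partial sum at [s + t] has nonnegative coefficients, so its norm is
   controlled by its value at 1, which tends to e^s e^t - e^(s+t) = 0. *)
have H1 : poly_act (exp_poly N s) (poly_act (exp_poly N t) u) @[N --> \oo]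
    --> exp_act (s + t) u.
  have -> : exp_act (s + t) u = 0 + exp_act (s + t) u by rewrite add0r.
  have -> : (fun N => poly_act (exp_poly N s) (poly_act (exp_poly N t) u)) =
     (fun N => poly_act (exp_poly N s * exp_poly N t - exp_poly N (s + t)) u
        + poly_act (exp_poly N (s + t)) u).
    by apply/funext => N; rewrite poly_actB subrK poly_actM.
  apply: cvgD; last exact: cvg_exp_act.
  apply/norm_cvg0P.
  apply: (squeeze_cvgr (f := fun=> 0)
    (h := fun N => ((exp_poly N s).[1] * (exp_poly N t).[1] -
      (exp_poly N (s + t)).[1]) * `|u|)).
  - apply: nearW => N; rewrite normr_ge0/=.
    rewrite -hornerM -hornerN -hornerD norm_poly_act_le// => i.
    exact: exp_polyM_ge0.
  - exact: cvg_cst.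
  - rewrite -[X in _ --> X](mul0r `|u|); apply: cvgMr_tmp.
    have -> : 0 = expR s * expR t - expR (s + t) :> R by rewrite expRD subrr.
    by apply: cvgB; [apply: cvgM|]; exact: cvg_exp_poly1.
(* The outer operators have norm at most their value at 1, which converges to e^s, so the inner
   partial sum may be replaced by its limit. *)
have H2 : poly_act (exp_poly N s) (poly_act (exp_poly N t) u) @[N --> \oo]
    --> exp_act s (exp_act t u).
  have -> : exp_act s (exp_act t u) = 0 + exp_act s (exp_act t u) by rewrite add0r.
  have -> : (fun N => poly_act (exp_poly N s) (poly_act (exp_poly N t) u)) =
     (fun N => poly_act (exp_poly N s) (poly_act (exp_poly N t) u - exp_act t u)
        + poly_act (exp_poly N s) (exp_act t u)).
    by apply/funext => N; rewrite poly_actBr subrK.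
  apply: cvgD; last exact: cvg_exp_act.
  apply/norm_cvg0P.
  apply: (squeeze_cvgr (f := fun=> 0)
     (h := fun N => (exp_poly N s).[1] * `|poly_act (exp_poly N t) u - exp_act t u|)).
  - apply: nearW => N; rewrite normr_ge0/= norm_poly_act_le// => i.
    exact: exp_poly_ge0.
  - exact: cvg_cst.
  - rewrite -[X in _ --> X](mulr0 (expR s)).
    apply: cvgM; first exact: cvg_exp_poly1.
    apply/norm_cvg0P; rewrite -(subrr (exp_act t u)).
    by apply: cvgB; [exact: cvg_exp_act|exact: cvg_cst].
exact: (cvg_unique _ H1 H2).
Qed.

(** This is e^(s(B - 1)): the scalar factor offsets the bound e^s on the norm of e^(sB). *)
Definition contraction_exp (s : R) (u : V) : V := expR (- s) *: exp_act s u.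

Lemma contraction_exp_linear s : linear (contraction_exp s).
Proof.
by move=> a u v; rewrite /contraction_exp exp_act_linear scalerDr !scalerA mulrC.
Qed.

Lemma contraction_exp0 u : contraction_exp 0 u = u.
Proof.
rewrite /contraction_exp oppr0 expR0 scale1r; apply/eqP.
rewrite -subr_eq0 -normr_le0 -[X in _ - X]scale1r -poly_actC.
rewrite (le_trans (norm_exp_act_sub_le _ _))//; last first.
  by rewrite expR0 hornerC subrr mul0r.
(* The empty partial sum [N] = 0 lacks the constant term 1. *)
exists 1%N => // N /= N1 i; rewrite coefB coef_exp_poly coefC.
case: i => [|i]; first by rewrite N1 /exp_coeff/= expr0 fact0 divr1 subrr.
by rewrite subr0; case: ifP => // _; rewrite exp_coeff_ge0.
Qed.

Lemma contraction_expD s t u : 0 <= s -> 0 <= t ->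
  contraction_exp (s + t) u = contraction_exp s (contraction_exp t u).
Proof.
move=> s0 t0; rewrite /contraction_exp exp_actD// opprD expRD.
by rewrite exp_actZ scalerA.
Qed.

Lemma norm_contraction_exp_le s u : 0 <= s -> `|contraction_exp s u| <= `|u|.
Proof.
move=> s0; rewrite normrZ ger0_norm ?expR_ge0//.
rewrite (le_trans (ler_wpM2l (expR_ge0 _) (norm_exp_act_le u s0)))//.
by rewrite mulrA -expRD addNr expR0 mul1r.
Qed.

(* The coefficients of [e^-s (exp (s B) - 1 - s B)], [(e^-s - 1 + s)] and
   [(e^-s - 1) s B] have total variation [2 s (1 - e^-s)]. *)
Lemma norm_contraction_exp_sub_le s u : 0 <= s ->
  `|contraction_exp s u - u - s *: (B u - u)| <= 2 * s ^+ 2 * `|u|.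
Proof.
move=> s0; pose p : {poly R} := 1 + s *: 'X.
have pE : poly_act p u = u + s *: B u.
  by rewrite poly_actD poly_actZ poly_actX -[1]/(1%:P) poly_actC scale1r.
have H : `|exp_act s u - poly_act p u| <= (expR s - (1 + s)) * `|u|.
  have -> : 1 + s = p.[1] by rewrite !hornerE.
  apply: norm_exp_act_sub_le; exists 2%N => // N /= N2 i.
  rewrite coefB coef_exp_poly /p coefD coefZ coefX coef1.
  case: i => [|[|i]]; last first.
  - by rewrite mulr0 addr0 subr0; case: ifP => // _; rewrite exp_coeff_ge0.
  - by rewrite N2 exp_coeffE/= factS fact0 muln1 invr1 mul1r expr1 mulr1 add0r subrr.
  - by rewrite (ltnW N2) /exp_coeff/= expr0 fact0 divr1 mulr0 addr0 subrr.
have eE : contraction_exp s u - u - s *: (B u - u) =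
    expR (- s) *: (exp_act s u - poly_act p u) + (expR (- s) - 1 + s) *: u
    + ((expR (- s) - 1) * s) *: B u.
  rewrite /contraction_exp pE; set e := expR (- s); set w := exp_act s u.
  have zE (a P v q z x y : V) : P = v + q -> a - x - (y - z) =
      a - P + (v - x + z) + (q - y).
    move=> ->; rewrite -[RHS]addrA.
    have -> : v - x + z + (q - y) = v + q + (- x + z - y).
      by rewrite -[v - x + z]addrA addrACA.
    by rewrite [RHS]addrA subrK opprB -!addrA.
  have -> : e *: (w - (u + s *: B u)) = e *: w - (e *: u + (e * s) *: B u).
    by rewrite scalerBr scalerDr scalerA.
  rewrite [s *: (_ - _)]scalerBr scalerDl scalerBl scale1r mulrBl mul1r scalerBl.
  exact: zE.
rewrite eE.
have e1 : expR (- s) <= 1 by rewrite -expR0 ler_expR oppr_le0.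
have e2 : 1 - s <= expR (- s) by exact: expR_ge1Dx.
rewrite (le_trans (ler_normD _ _))//.
(* The [B u] term takes the share s(1 - e^-s). The other two terms together are also bounded by s(1
   - e^-s), and 1 - e^-s <= s brings the total below 2 s^2. *)
have -> : 2 * s ^+ 2 * `|u| = (2 * s ^+ 2 - s * (1 - expR (- s))) * `|u| +
    s * (1 - expR (- s)) * `|u|.
  by rewrite -mulrDl subrK.
apply: lerD; last first.
  rewrite normrZ normrM (ger0_norm s0) distrC ger0_norm ?subr_ge0// mulrC [s * _]mulrC.
  by rewrite mulrC ler_wpM2l// mulr_ge0// subr_ge0.
rewrite (le_trans (ler_normD _ _))// !normrZ ger0_norm ?expR_ge0//.
rewrite [X in X * `|u|]ger0_norm; last by lra.
apply: (@le_trans _ _ (expR (- s) * ((expR s - (1 + s)) * `|u|) +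
    (expR (- s) - 1 + s) * `|u|)).
  by rewrite lerD2r ler_wpM2l ?expR_ge0.
rewrite mulrA -mulrDl ler_wpM2r//.
rewrite mulrBr -expRD addNr expR0.
nra.
Qed.

End contraction_exponential.

(** For B = 1 + h A one has A = (B - 1)/h, so [contraction_exp B (t / h)] is e^(tA). Its difference
    quotients at 0 converge to A u for every u, and uniqueness of limits identifies the generator
    with the full graph of A. *)
Lemma bounded_dissipative_generates (R : realType) (V : normedModType R)
    (A : {linear V -> V}) (h : R) : 0 < h ->
  (forall u : nat -> V, cvgn (series (fun k => `|u k|)) -> cvgn (series u)) ->
  (forall u, `|u + h *: A u| <= `|u|) ->
  generates_contraction_semigroup A.
Proof.
move=> h0 Vc Ah.
have Blin : linear (fun u => u + h *: A u).
  move=> a u v; rewrite linearP !scalerDr !scalerA mulrC -!addrA.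
  by congr (_ + _); rewrite addrCA.
pose B : {linear V -> V} := HB.pack (fun u => u + h *: A u)
  (GRing.isLinear.Build R V V _ (fun u => u + h *: A u) Blin).
pose S t := contraction_exp B (t / h).
have Slin t : linear (S t) by exact: contraction_exp_linear.
pose T t : {linear V -> V} := HB.pack (S t) (GRing.isLinear.Build R V V _ (S t) (Slin t)).
have th0 t : 0 <= t -> 0 <= t / h by move=> t0; rewrite divr_ge0// ltW.
(* The constant is the quadratic error 2 (t/h)^2 divided by t. *)
have diff t u : 0 < t -> `|t^-1 *: (T t u - u) - A u| <= t * (2 / h ^+ 2 * `|u|).
  move=> t0; have tn0 : t != 0 by rewrite gt_eqF.
  have -> : t^-1 *: (T t u - u) - A u = t^-1 *: (T t u - u - (t / h) *: (B u - u)).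
    rewrite [RHS]scalerBr; congr (_ - _).
    by rewrite /= addrC addKr !scalerA mulrA mulVf// mul1r mulVf ?gt_eqF// scale1r.
  rewrite normrZ gtr0_norm ?invr_gt0//.
  have := @norm_contraction_exp_sub_le R V B Ah Vc (t / h) u (th0 _ (ltW t0)).
  move=> /(ler_wpM2l (ltW (_ : 0 < t^-1))) -/(_ _)/le_trans; apply.
    by rewrite invr_gt0.
  by rewrite le_eqVlt; apply/orP; left; apply/eqP; field; rewrite tn0 gt_eqF.
have cvgA u : t^-1 *: (T t u - u) @[t --> 0^'+] --> A u.
  apply/subr_cvg0; apply/norm_cvg0P.
  apply: (squeeze_cvgr (f := fun=> 0) (h := fun t => t * (2 / h ^+ 2 * `|u|))).
  - near=> t; rewrite normr_ge0/= diff//.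
  - exact: cvg_cst.
  - rewrite -[X in _ --> X](mul0r (2 / h ^+ 2 * `|u|)); apply: cvgMr_tmp.
    exact: cvg_at_right_filter.
exists T; split; first split.
- by move=> u /=; rewrite /S mul0r contraction_exp0.
- by move=> s t s0 t0 u /=; rewrite /S mulrDl contraction_expD// th0.
- by move=> t u t0; exact: (@norm_contraction_exp_le R V B Ah Vc (t / h) u (th0 _ t0)).
(* Strong continuity follows from differentiability at 0: T_t u - u is t times a convergent
   quotient. *)
- move=> u; apply/subr_cvg0.
  have : t *: (t^-1 *: (T t u - u)) @[t --> 0^'+] --> 0 *: A u.
    by apply: cvgZ => //; exact: cvg_at_right_filter.
  rewrite scale0r; apply: cvg_trans; apply: near_eq_cvg; near=> t.
  by rewrite scalerA mulfV// scale1r.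
- apply/seteqP; split=> -[u v] /=; last by move=> ->; exact: cvgA.
  by move=> uv; exact: (cvg_unique _ uv (cvgA u)).
Unshelve. all: by end_near.
Qed.

(** * Contractivity of the steps 1 + h L0 *)

Lemma L1classZ d (T : measurableType d) (R : realType)
    (mu : {measure set T -> \bar R}) (a : R) (f : L1fun mu) :
  L1class (a *: f) = a *: L1class f.
Proof.
apply/L1class_eq; apply: filterS (L1classP f) => x H Dx.
exact: (congr1 ( *%R a) (esym (H Dx))).
Qed.

Lemma L1classZD d (T : measurableType d) (R : realType)
    (mu : {measure set T -> \bar R}) (a : R) (f g : L1fun mu) :
  L1class (a *: f + g) = a *: L1class f + L1class g.
Proof. by rewrite L1classD L1classZ. Qed.

Section L1map_linear.
Context d1 d2 (S : measurableType d1) (T : measurableType d2) (R : realType).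
Variables (mu : {measure set S -> \bar R}) (nu : {measure set T -> \bar R}).

Lemma L1map_linear (F : (S -> R) -> T -> R) : maps_L1 mu nu F ->
  (forall a (f g : S -> R), f \in Lfun mu 1 -> g \in Lfun mu 1 ->
    \forall x \ae nu, F (fun z => a * f z + g z) x = a * F f x + F g x) ->
  linear (L1map mu nu F).
Proof.
move=> LF Flin a u v; rewrite -(L1reprK u) -(L1reprK v).
set f := L1repr u; set g := L1repr v.
have Lf : (f : S -> R) \in Lfun mu 1 by exact: LfunP.
have Lg : (g : S -> R) \in Lfun mu 1 by exact: LfunP.
have Lfg : (a *: f + g : S -> R) \in Lfun mu 1 by exact: LfunP.
apply: etrans (congr1 (L1map mu nu F) (esym (L1classZD a f g))) _.
rewrite (L1map_class (LF.1 _ Lf) LF) (L1map_class (LF.1 _ Lg) LF).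
rewrite (L1map_class (LF.1 _ Lfg) LF).
apply: etrans _ (L1classZD a (Lfun_Sub _ (LF.1 f Lf)) (Lfun_Sub _ (LF.1 g Lg))).
by apply/L1class_eq; apply: filterS (Flin a f g Lf Lg) => x + _.
Qed.
End L1map_linear.

Section generator.
Context (R : realType) (d : nat) (c : Rd R d -> Rd R d -> Rd R d -> Rd R d -> R).
Hypothesis c_measurable :
  measurable_fun [set: Rd R d * Rd R d * Rd R d * Rd R d]
       (fun z => c z.1.1.1 z.1.1.2 z.1.2 z.2).
Hypothesis c_ge0 : forall x1 x2 y1 y2, 0 <= c x1 x2 y1 y2.
Hypotheses (c1y : (c1 c < +oo)%E) (c2y : (c2 c < +oo)%E).
Local Notation E := (Rd R d).
Local Notation mu := (leb R d).

Lemma L0_fun_pairE n f x :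
  L0_fun c (n:=n) f x =
  \sum_(p : 'I_n * 'I_n | (p.1 < p.2)%N) pair_op c p.1 p.2 f x.
Proof. by rewrite L0_funE (pair_big_dep predT (fun i j : 'I_n => (i < j)%N)). Qed.

Lemma rate_at_ge0 n (i j : 'I_n) x y : (0 <= rate_at c i j x y)%E.
Proof. by rewrite lee_fin. Qed.

Lemma L0_linear n : linear (@L0 R d c n).
Proof.
have [M1 [M10 _ a1M]] := c1P c_ge0 c1y.
have [M2 [M20 _ a2M]] := c2P c_ge0 c2y.
apply: L1map_linear.
  by have [] := L0_L1bounded c_measurable c_ge0 n M10 a1M M20 a2M.
move=> a f g Lf Lg.
have H (p : 'I_n * 'I_n) : (p.1 < p.2)%N -> \forall x \ae conf_leb R d n,
    pair_op c p.1 p.2 (fun z => a * f z + g z) x =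
    a * pair_op c p.1 p.2 f x + pair_op c p.1 p.2 g x.
  move=> p12; have {}p12 : p.1 != p.2 by rewrite neq_ltn p12.
  apply: (@kernel_op_linear _ _ _ _ _ _ _ (conf_leb R d n) (conf_leb R d n)
    (sfprod mu mu) (rate_at c p.1 p.2) (jump p.1 p.2) id M2 M1) => //.
  - by move=> x y; rewrite lee_fin c_ge0.
  - exact: measurable_rate_at.
  - exact: measurable_jump.
  - exact: jump_le.
  - exact: stay_le.
have {}H : \forall x \ae conf_leb R d n, forall p : 'I_n * 'I_n, (p.1 < p.2)%N ->
    pair_op c p.1 p.2 (fun z => a * f z + g z) x =
    a * pair_op c p.1 p.2 f x + pair_op c p.1 p.2 g x.
  apply: filter_forall => p.
  by have [p12|np] := boolP (p.1 < p.2)%N; [apply: filterS (H _ p12)|exact/nearW].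
apply: filterS H => x Hx; rewrite !L0_fun_pairE mulr_sumr -big_split.
by apply: eq_bigr => p p12; exact: Hx.
Qed.

(** The coefficient 1 - h sum [al] of [g] is nonnegative, so its contribution and the added loss on
    the left sum to exactly |g|. *)
Lemma norm_sub_sum_le (I : finType) (P : pred I) (al be J : I -> R) (h g : R) :
  0 <= h -> h * \sum_(p | P p) al p <= 1 ->
  (forall p, P p -> `|J p| <= be p) ->
  `|g + h * \sum_(p | P p) (J p - al p * g)| + h * \sum_(p | P p) al p * `|g| <=
  `|g| + h * \sum_(p | P p) be p.
Proof.
move=> h0 h1 Jbe; rewrite sumrB -!mulr_suml.
set al_ := \sum_(p | P p) al p in h1 *.
have -> : g + h * (\sum_(i | P i) J i - al_ * g) =
    (1 - h * al_) * g + h * \sum_(i | P i) J i by ring.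
apply: (@le_trans _ _ ((1 - h * al_) * `|g| + h * `|\sum_(i | P i) J i| +
    h * (al_ * `|g|))).
  rewrite lerD2r (le_trans (ler_normD _ _))// !normrM ger0_norm ?subr_ge0//.
  by rewrite (ger0_norm h0).
have -> : (1 - h * al_) * `|g| + h * `|\sum_(i | P i) J i| + h * (al_ * `|g|) =
  `|g| + h * `|\sum_(i | P i) J i| by ring.
rewrite lerD2l ler_wpM2l// (le_trans (ler_norm_sum _ _ _))//.
exact: ler_sum.
Qed.

Hypothesis a21 : \forall x \ae (mu \x mu)%E, (a2 c x.1 x.2 <= a1 c x.1 x.2)%E.

(** [M] bounds a_2 as well, so L_0 acts on L^1; through [hM] it keeps h sum a_1 at most 1; and it
    makes the integrated loss finite, hence cancellable. *)
Lemma L0_step_contraction n (M : R) h (u : X R d n) : 0 <= h -> 0 <= M ->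
  (\forall x \ae (mu \x mu)%E, (a1 c x.1 x.2 <= M%:E)%E) ->
  h * (n%:R * (n%:R - 1) / 2 * M) <= 1 ->
  `|u + h *: L0 c u| <= `|u|.
Proof.
move=> h0 M0 a1M hM.
have a2M : \forall x \ae (mu \x mu)%E, (a2 c x.1 x.2 <= M%:E)%E.
  by apply: filterS2 a21 a1M => x; exact: le_trans.
have [_ LF _] := L0_L1bounded c_measurable c_ge0 n M0 a1M M0 a2M.
rewrite -(L1reprK u); set f := L1repr u.
have Lf : (f : _ -> R) \in Lfun (conf_leb R d n) 1 by exact: LfunP.
have /Lfun1P[mf fy] := Lf.
rewrite /L0 (L1map_class (LF.1 _ Lf) LF) -L1classZ -L1classD -lee_fin !L1normP !Lnorm1.
set g : L1fun _ := _ + _.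
have gE x : g x = f x + h * L0_fun c f x by [].
have mabs : measurable_fun setT (fun x => `|f x|%:E).
  by apply/measurable_EFinP/measurableT_comp.
pose al (p : 'I_n * 'I_n) (x : n.-tuple E) := a1 c (tnth x p.1) (tnth x p.2).
pose be (p : 'I_n * 'I_n) (x : n.-tuple E) :=
  (\int[mu \x mu]_y (rate_at c p.1 p.2 x y * `|f (jump p.1 p.2 x y)|%:E))%E.
have al0 p x : (0 <= al p x)%E by apply: integral_ge0 => y _; rewrite lee_fin.
have be0 p x : (0 <= be p x)%E.
  by apply: integral_ge0 => y _; rewrite mule_ge0 ?lee_fin.
have mal p : measurable_fun setT (al p).
  apply: (measurableT_comp (measurable_a1 c_measurable c_ge0)
    (g := fun x : n.-tuple E => (tnth x p.1, tnth x p.2))).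
  by apply: measurable_fun_pair; exact: measurable_tnth.
have mbe p : measurable_fun setT (be p).
  apply: (@measurable_int_r _ _ _ _ _ (sfprod mu mu)) => [x y|].
    by rewrite mule_ge0 ?lee_fin.
  exact: (measurable_kernel_mul (measurable_rate_at c_measurable p.1 p.2)
    (measurable_jump p.1 p.2) mabs).
have malf p : measurable_fun setT (fun x => al p x * `|f x|%:E)%E.
  exact: emeasurable_funM.
have alM (p : 'I_n * 'I_n) : (p.1 < p.2)%N ->
    \forall x \ae conf_leb R d n, (al p x <= M%:E)%E.
  move=> p12; apply: (ae_tnth2 (P := fun z => (a1 c z.1 z.2 <= M%:E)%E)) => //.
  by rewrite neq_ltn p12.
(* The exchange of variables turns the integrated gain into an integral weighted by a_2, and here
   a_2 <= a_1 makes it at most the loss. *)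
have aba (p : 'I_n * 'I_n) : (p.1 < p.2)%N ->
    (\int[conf_leb R d n]_x be p x <= \int[conf_leb R d n]_x (al p x * `|f x|%:E))%E.
  move=> p12; have p12' : p.1 != p.2 by rewrite neq_ltn p12.
  have absf0 x : (0 <= `|f x|%:E)%E by [].
  rewrite [leLHS](@integral_jump_a2 R d c c_measurable c_ge0 n p.1 p.2
    (fun x => `|f x|%:E%E) p12' absf0 mabs).
  apply: ae_ge0_le_integral => //.
  - by move=> x _; rewrite mule_ge0//; apply: integral_ge0 => y _; rewrite lee_fin.
  - apply: emeasurable_funM => //.
    apply: (measurableT_comp (measurable_a2 c_measurable c_ge0)
      (g := fun x : n.-tuple E => (tnth x p.1, tnth x p.2))).
    by apply: measurable_fun_pair; exact: measurable_tnth.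
  - by move=> x _; rewrite mule_ge0.
  - have := ae_tnth2 p12' a21; apply: filterS => x /= ax _.
    exact: lee_wpmul2r.
have alfy (p : 'I_n * 'I_n) : (p.1 < p.2)%N ->
    (\int[conf_leb R d n]_x (al p x * `|f x|%:E) < +oo)%E.
  move=> p12; apply: (@le_lt_trans _ _ (\int[conf_leb R d n]_x (M%:E * `|f x|%:E))%E).
    apply: ae_ge0_le_integral => //.
    - by move=> x _; rewrite mule_ge0.
    - by move=> x _; rewrite mule_ge0 ?lee_fin.
    - exact: measurable_funeM.
    - by apply: filterS (alM _ p12) => x ax _; exact: lee_wpmul2r.
  by rewrite ge0_integralZl// ?lte_mul_pinfty ?lee_fin.
pose P (p : 'I_n * 'I_n) := (p.1 < p.2)%N.
have pointwise : \forall x \ae conf_leb R d n,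
    (`|g x|%:E + h%:E * \sum_(p | P p) (al p x * `|f x|%:E) <=
     `|f x|%:E + h%:E * \sum_(p | P p) be p x)%E.
  have H : \forall x \ae conf_leb R d n, forall p, P p ->
      (al p x <= M%:E)%E /\ (be p x < +oo)%E.
    apply: filter_forall => p.
    have [p12|np] := boolP (P p); last exact/nearW.
    (* The gain is finite a.e. because its integral is dominated by that of the loss. *)
    have bey : \forall x \ae conf_leb R d n, (be p x < +oo)%E.
      apply: ge0_integral_lty_ae => //.
      exact: (le_lt_trans (aba _ p12) (alfy _ p12)).
    by apply: filterS2 (alM _ p12) bey.
  apply: filterS H => x Hx.
  have HJ p : exists J : R, P p ->
      pair_op c p.1 p.2 f x = J - fine (al p x) * f x /\ `|J| <= fine (be p x).
    have [p12|np] := boolP (P p); last by exists 0.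
    have [alx bex] := Hx _ p12.
    have [J J1 J2] := kernel_op_split (eta := sfprod mu mu) id (rate_at_ge0 p.1 p.2)
      (measurable_rate_at c_measurable p.1 p.2) (measurable_jump p.1 p.2)
      (fun y => erefl : rate_at c p.1 p.2 x y \is a fin_num) mf bex
      (le_lt_trans alx (ltry _)).
    by exists J.
  have [J {}HJ] := choice HJ.
  rewrite gE L0_fun_pairE (eq_bigr (fun p => J p - fine (al p x) * f x)); last first.
    by move=> p p12; have [] := HJ _ p12.
  have -> : (\sum_(p | P p) (al p x * `|f x|%:E) =
      (\sum_(p | P p) fine (al p x) * `|f x|)%:E)%E.
    rewrite -sumEFin; apply: eq_bigr => p p12; rewrite EFinM fineK//.
    by rewrite ge0_fin_numE// (le_lt_trans (Hx _ p12).1)// ltry.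
  have -> : (\sum_(p | P p) be p x = (\sum_(p | P p) fine (be p x))%:E)%E.
    rewrite -sumEFin; apply: eq_bigr => p p12; rewrite fineK//.
    by rewrite ge0_fin_numE// (Hx _ p12).2.
  rewrite -!EFinM -!EFinD lee_fin; apply: norm_sub_sum_le => //; last first.
    by move=> p p12; have [] := HJ _ p12.
  apply: le_trans hM; apply: ler_wpM2l => //.
  rewrite -sum_pairs_cst (pair_big_dep predT (fun i j : 'I_n => (i < j)%N))/=.
  apply: ler_sum => p p12; rewrite -lee_fin fineK ?(Hx _ p12).1//.
  by rewrite ge0_fin_numE// (le_lt_trans (Hx _ p12).1)// ltry.
have hsum0 (w : 'I_n * 'I_n -> n.-tuple E -> \bar R) x :
    (forall p x, (0 <= w p x)%E) -> (0 <= h%:E * \sum_(p | P p) w p x)%E.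
  by move=> w0; rewrite mule_ge0 ?lee_fin// sume_ge0.
have malf0 p x : (0 <= al p x * `|f x|%:E)%E by rewrite mule_ge0.
have msum0 (w : 'I_n * 'I_n -> n.-tuple E -> \bar R) :
    (forall p, measurable_fun setT (w p)) ->
    measurable_fun setT (fun x => \sum_(p | P p) w p x)%E.
  move=> mw; rewrite (_ : (fun x => _) =
      (fun x => \sum_(p <- [seq p <- index_enum _ | P p]) w p x)%E).
    exact: emeasurable_sum.
  by apply/funext => x; rewrite big_filter.
have intsum (w : 'I_n * 'I_n -> n.-tuple E -> \bar R) :
    (forall p x, (0 <= w p x)%E) -> (forall p, measurable_fun setT (w p)) ->
    (\int[conf_leb R d n]_x (h%:E * \sum_(p | P p) w p x) =
     h%:E * \sum_(p | P p) \int[conf_leb R d n]_x w p x)%E.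
  move=> w0 mw; rewrite ge0_integralZl ?lee_fin//; last 2 first.
  - exact: msum0.
  - by move=> x _; exact: sume_ge0.
  rewrite -[in RHS]big_filter -ge0_integral_sum//; congr (_ * _)%E.
  by apply: eq_integral => x _; rewrite big_filter.
have msum (w : 'I_n * 'I_n -> n.-tuple E -> \bar R) :
    (forall p, measurable_fun setT (w p)) ->
    measurable_fun setT (fun x => h%:E * \sum_(p | P p) w p x)%E.
  by move=> mw; apply: measurable_funeM; exact: msum0.
have mg : measurable_fun setT (fun x => `|g x|%:E).
  by apply/measurable_EFinP/measurableT_comp => //; exact: measurable_funPT.
pose A := (h%:E * \sum_(p | P p) \int[conf_leb R d n]_x (al p x * `|f x|%:E))%E.
have Afin : A \is a fin_num.
  rewrite fin_numM// ge0_fin_numE.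
    by apply: lte_sum_pinfty => p; exact: alfy.
  by apply: sume_ge0 => p _; apply: integral_ge0.
pose alf (p : 'I_n * 'I_n) x := (al p x * `|f x|%:E)%E.
(* Adding the loss to both sides is reversible in the extended reals because [A] is finite. *)
rewrite -(leeD2rE _ _ Afin).
apply: (@le_trans _ _ (\int[conf_leb R d n]_x
    (`|g x|%:E + h%:E * \sum_(p | P p) (al p x * `|f x|%:E)))%E).
  rewrite ge0_integralD//; last 2 first.
  - by move=> x _; exact: (hsum0 alf).
  - exact: (msum alf).
  by rewrite (intsum alf).
apply: (@le_trans _ _ (\int[conf_leb R d n]_x
    (`|f x|%:E + h%:E * \sum_(p | P p) be p x))%E).
  apply: ae_ge0_le_integral => //.
  - by move=> x _; rewrite adde_ge0//; exact: (hsum0 alf).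
  - by apply: emeasurable_funD => //; exact: (msum alf).
  - by move=> x _; rewrite adde_ge0//; exact: (hsum0 be).
  - by apply: emeasurable_funD => //; exact: (msum be).
  - by apply: filterS pointwise.
rewrite ge0_integralD//; last 2 first.
- by move=> x _; exact: (hsum0 be).
- exact: (msum be).
rewrite (intsum be)//; apply: leeD => //; apply: lee_wpmul2l; first by rewrite lee_fin.
by apply: lee_sum => p p12; exact: aba.
Qed.

Lemma L0_generates n : generates_contraction_semigroup (@L0 R d c n).
Proof.
have [M1 [M10 _ a1M]] := c1P c_ge0 c1y.
pose C := n%:R * (n%:R - 1) / 2 * M1.
have C0 : 0 <= C.
  rewrite /C -sum_pairs_cst; apply: sumr_ge0 => i _; exact: sumr_ge0.
pose A : {linear X R d n -> X R d n} := HB.pack (@L0 R d c n)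
  (GRing.isLinear.Build R (X R d n) (X R d n) _ (@L0 R d c n) (@L0_linear n)).
(* With h = 1/(C + 1) one has h C <= 1, and h stays meaningful when C = 0, in particular for n <=
   1. *)
apply: (@bounded_dissipative_generates R (X R d n) A (C + 1)^-1).
- by rewrite invr_gt0 ltr_wpDl.
- exact: L1space_complete.
- move=> u; apply: (L0_step_contraction u _ M10 a1M).
    by rewrite invr_ge0 addr_ge0.
  by rewrite -/C mulrC ler_pdivrMr ?mul1r ?lerDl// ltr_wpDl.
Qed.

End generator.

Theorem proposition3p3 (R : realType) (d : nat)
    (c : Rd R d -> Rd R d -> Rd R d -> Rd R d -> R)
    (d_gt0 : (0 < d)%N)
    (c_measurable : measurable_fun [set: Rd R d * Rd R d * Rd R d * Rd R d]
       (fun z => c z.1.1.1 z.1.1.2 z.1.2 z.2))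
    (c_ge0 : forall x1 x2 y1 y2, 0 <= c x1 x2 y1 y2)
    (c_symx : forall x1 x2 y1 y2, c x1 x2 y1 y2 = c x2 x1 y1 y2)
    (c_symy : forall x1 x2 y1 y2, c x1 x2 y1 y2 = c x1 x2 y2 y1)
    (c_loc : \forall x \ae (leb R d \x leb R d)%E,
       L1loc (fun y => c x.1 x.2 y.1 y.2)) :
  ((c1 c < +oo)%E -> (c2 c < +oo)%E ->
     (forall n : nat, L0_well_defined c n /\
        forall G : X R d n,
          ((`|L0 c G|)%:E <=
             (n%:R * (n%:R - 1) / 2)%:E * (c1 c + c2 c) * (`|G|)%:E)%E) /\
     ((\forall x \ae (leb R d \x leb R d)%E, (a2 c x.1 x.2 <= a1 c x.1 x.2)%E) ->
        forall n : nat, generates_contraction_semigroup (@L0 R d c n))) /\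
  ((c3 c < +oo)%E -> (c4 c < +oo)%E ->
     forall n : nat, (0 < n)%N -> W_well_defined c n /\
        forall G : X R d n.-1,
          ((`|W c G|)%:E <=
             (n%:R * (n%:R - 1))%:E * (c3 c + c4 c) * (`|G|)%:E)%E).
Proof.
split=> [c1y c2y|c3y c4y n n0]; split.
- move=> n; split; first exact: L0_well.
  by move=> G; exact: L0_norm_le.
- by move=> a21 n; exact: L0_generates.
- exact: W_well.
- by move=> G; exact: W_norm_le.
Qed.
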